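(* Let $\mathcal X,\mathcal Y,\mathcal Z,\widetilde{\mathcal Z},\mathfrak Z,A,f,\Psi,\mu,\mathfrak L,\Delta,\mathfrak C,B$ be as in the setting described in the context, $J_{\Psi_B\circ\mathfrak L}=f\circ A+\mu\Psi_B\circ\mathfrak L$, and $\mathfrak d:=f\circ A-\frac{\mu}{2}\|B\mathfrak L\cdot\|_{\widetilde{\mathcal Z}}^2$. Assume: (ii) $\mathfrak d\in\Gamma_0(\mathcal X)$; (iii) the solution set $\mathcal S\subset\mathcal X$ of $\operatorname{minimize}_{\mathfrak Cx\in\Delta}J_{\Psi_B\circ\mathfrak L}(x)$ is nonempty; (iv) $\partial(J_{\Psi_B\circ\mathfrak L}+\iota_\Delta\circ\mathfrak C)=\partial J_{\Psi_B\circ\mathfrak L}+\partial(\iota_\Delta\circ\mathfrak C)$, $\ \partial(\Psi\circ\mathfrak L)=\mathfrak L^*\circ\partial\Psi\circ\mathfrak L$, and $\partial(\iota_\Delta\circ\mathfrak C)=\mathfrak C^*\circ\partial\iota_\Delta\circ\mathfrak C$. Let $\beta_{\nabla\mathfrak d}>0$ be a Lipschitz constant of $\nabla\mathfrak d=\nabla(f\circ A)-\mu\mathfrak L^*B^*B\mathfrak L$ and $\rho:=1/\max\{\beta_{\nabla\mathfrak d},\mu\|B\|_{\rm op}^2\}$. On $\mathcal H:=\mathcal X\times\mathcal Z\times\mathcal Z\times\mathfrak Z$ define, for $(\sigma,\tau)\in(0,\infty)^2$, $T:\mathcal H\to\mathcal H:(x,v,w,z)\mapsto(\xi,\zeta,\eta,\varsigma)$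 by $$\begin{aligned}\xi&:=\left(\mathrm{Id}-\tfrac1\sigma\nabla\mathfrak d\right)(x)-\tfrac\mu\sigma\mathfrak L^*B^*Bv-\tfrac\mu\sigma\mathfrak L^*w-\tfrac\mu\sigma\mathfrak C^*z,\\ \zeta&:=\operatorname{Prox}_{\frac\mu\tau\Psi}\left[\tfrac{2\mu}{\tau}B^*B\mathfrak L\xi-\tfrac\mu\tau B^*B\mathfrak Lx+\left(\mathrm{Id}-\tfrac\mu\tau B^*B\right)(v)\right],\\ \eta&:=\operatorname{Prox}_{\Psi^*}(2\mathfrak L\xi-\mathfrak Lx+w),\\ \varsigma&:=(\mathrm{Id}-P_\Delta)(2\mathfrak C\xi-\mathfrak Cx+z).\end{aligned}$$ Then: (a) $x^\diamond\in\mathcal S$ if and only if there exists $(v^\diamond,w^\diamond,z^\diamond)\in\mathcal Z\times\mathcal Z\times\mathfrak Z$ such that $(0_{\mathcal X},0_{\mathcal Z},0_{\mathcal Z},0_{\mathfrak Z})\in(F+G)(x^\diamond,v^\diamond,w^\diamond,z^\diamond)$, where $F:\mathcal H\to\mathcal H$ and $G:\mathcal H\to2^{\mathcal H}$ are $$F(x,v,w,z)=(\nabla\mathfrak d(x),\mu B^*Bv,0_{\mathcal Z},0_{\mathfrak Z}),$$ $$G(x,v,w,z)=\{\mu\mathfrak L^*B^*Bv+\mu\mathfrak L^*w+\mu\mathfrak C^*z\}\times(-\mu B^*B\mathfrak Lx+\mu\partial\Psi(v))\times(-\mu\mathfrak Lx+\mu\partial\Psi^*(w))\times(-\mu\mathfrak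 Cx+\mu\partial\iota_\Delta^*(z)).$$ (b) With $\Xi:\mathcal H\to\mathcal X:(x,v,w,z)\mapsto x$, one has $\mathcal S=\Xi(\operatorname{Fix}T)$. (c) Choose $(\sigma,\tau)\in(0,\infty)\times(\frac1{2\rho},\infty)$ satisfying $$\sigma>\mu\|\mathfrak L^*\mathfrak L+\mathfrak C^*\mathfrak C\|_{\rm op}+\frac{2\rho\mu^2\|B^*B\mathfrak L\|_{\rm op}^2+\tau}{2\rho\tau-1}.\qquad(\ast)$$ Then $$\mathfrak P:=\begin{bmatrix}\sigma\mathrm{Id}&-\mu\mathfrak L^*B^*B&-\mu\mathfrak L^*&-\mu\mathfrak C^*\\-\mu B^*B\mathfrak L&\tau\mathrm{Id}&0&0\\-\mu\mathfrak L&0&\mu\mathrm{Id}&0\\-\mu\mathfrak C&0&0&\mu\mathrm{Id}\end{bmatrix}$$ is positive definite on $\mathcal H$, and $T$ is $\frac{2}{4-\theta}$-averaged nonexpansive over the Hilbert space $(\mathcal H,\langle\cdot,\cdot\rangle_{\mathfrak P},\|\cdot\|_{\mathfrak P})$ with $$\theta:=\frac{\sigma+\tau-\mu\|\mathfrak L^*\mathfrak L+\mathfrak C^*\mathfrak C\|_{\rm op}}{\rho\left(\sigma\tau-\tau\mu\|\mathfrak L^*\mathfrak L+\mathfrak C^*\mathfrak C\|_{\rm op}-\mu^2\|B^*B\mathfrak L\|_{\rm op}^2\right)}<2.$$ (d) With $(\sigma,\tau)\in(0,\infty)\times(\frac1{2\rho},\infty)$ satisfying $(\ast)$, for any initial point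 $h_0=(x_0,v_0,w_0,z_0)\in\mathcal H$, the sequence defined by $h_{k+1}:=T(h_k)$ ($k=0,1,2,\dots$) converges to a point in $\operatorname{Fix}T$, which implies that $x_k:=\Xi(h_k)$ converges to a point in $\mathcal S$.
   Context: Notation. All Hilbert spaces are finite-dimensional and real. $\Gamma_0(\mathcal H)$: proper lower semicontinuous convex functions $\mathcal H\to(-\infty,\infty]$; $\mathcal B(\mathcal H,\mathcal K)$: linear operators; $L^*$: adjoint; $\|\cdot\|_{\rm op}$: operator norm; $\varphi^*$: Legendre–Fenchel conjugate; $\partial\varphi$: convex subdifferential; $\operatorname{Prox}_\varphi(x)=\operatorname{argmin}_v[\varphi(v)+\frac12\|v-x\|^2]$; $\iota_\Delta$: indicator function ($0$ on $\Delta$, $\infty$ elsewhere); $P_\Delta$: metric projection onto $\Delta$; $\operatorname{Fix}T=\{h\mid T(h)=h\}$. Product spaces carry the sum inner product. For $\mathfrak P$ self-adjoint positive definite, $\langle\cdot,\cdot\rangle_{\mathfrak P}=\langle\mathfrak P\cdot,\cdot\rangle_{\mathcal H}$ and $\|\cdot\|_{\mathfrak P}$ is the induced norm. $T$ is $\alpha$-averaged nonexpansive ($\alpha\in(0,1)$) if $T=(1-\alpha)\mathrm{Id}+\alpha R$ for some $1$-Lipschitz $R$. $\varphi\in\Gamma_0(\mathcal H)$ is coercive if $\varphi(x)\to\infty$ as $\|x\|\to\infty$. Setting. $\mathcal X,\mathcal Y,\mathcal Z,\widetilde{\mathcal Z},\mathfrak Z$ are finite-dimensional real Hilbert spaces;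 $A\in\mathcal B(\mathcal X,\mathcal Y)$; $f\in\Gamma_0(\mathcal Y)$ is (real-valued and) differentiable over $\mathcal Y$ with $\beta_{\nabla f}$-Lipschitz continuous gradient over $\mathcal Y$ (this is assumption (i)); $\Psi\in\Gamma_0(\mathcal Z)$ is coercive (and prox-friendly, i.e. its proximity operators are computable, a purely computational requirement); $\mu>0$; $\mathfrak L\in\mathcal B(\mathcal X,\mathcal Z)$; $\Delta\subset\mathfrak Z$ is a closed convex set (simple, i.e. $P_\Delta$ is computable); $\mathfrak C\in\mathcal B(\mathcal X,\mathfrak Z)$; $B\in\mathcal B(\mathcal Z,\widetilde{\mathcal Z})$; and $\operatorname{dom}(\Psi\circ\mathfrak L)\cap\mathfrak C^{-1}(\Delta)\neq\emptyset$. The generalized Moreau enhanced (GME) function of $\Psi$ is $$\Psi_B(\cdot)=\Psi(\cdot)-\min_{v\in\mathcal Z}\Big[\Psi(v)+\tfrac12\|B(\cdot-v)\|_{\widetilde{\mathcal Z}}^2\Big].$$ *)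

(* Defs.v *)
From HB Require Import structures.
From mathcomp Require Import all_boot all_order all_algebra.
From mathcomp Require Import all_classical all_reals all_analysis.
From mathcomp Require Import ring lra.
Set Implicit Arguments.
Unset Strict Implicit.
Unset Printing Implicit Defensive.
Import Order.TTheory GRing.Theory Num.Theory.
Import numFieldNormedType.Exports.
Local Open Scope classical_set_scope.
Local Open Scope ring_scope.

(* Finite-dimensional real Hilbert spaces: a finite-dimensional normed module
   whose norm (hence topology) is the one induced by the inner product [ip]. *)
HB.mixin Record NormedVector_isEuclid (R : realType) V
    of NormedModule R V & Vector R V := {
  ip : V -> V -> R ;
  ipC : forall x y, ip x y = ip y x ;
  ipDl : forall x y z, ip (x + y) z = ip x z + ip y z ;
  ipZl : forall a x y, ip (a *: x) y = a * ip x y ;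
  ipxx : forall x, ip x x = `|x| ^+ 2
}.

#[short(type="euclidType")]
HB.structure Definition Euclid (R : realType) :=
  {V of NormedVector_isEuclid R V & NormedModule R V & Vector R V}.

(* An inner product on a bare finite-dimensional vector space suffices: the norm
   and the topology are built from it. *)
HB.factory Record Vector_isEuclid (R : realType) V of Vector R V := {
  dot : V -> V -> R ;
  dotC : forall x y, dot x y = dot y x ;
  dotDl : forall x y z, dot (x + y) z = dot x z + dot y z ;
  dotZl : forall a x y, dot (a *: x) y = a * dot x y ;
  dot_gt0 : forall x, x != 0 -> 0 < dot x x
}.

HB.builders Context R V of Vector_isEuclid R V.

Let norm x := Num.sqrt (dot x x).

Let dot0l y : dot 0 y = 0.
Proof. by rewrite -[X in dot X _](scale0r (0 : V)) dotZl mul0r. Qed.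

Let dotDr x y z : dot z (x + y) = dot z x + dot z y.
Proof. by rewrite dotC dotDl !(dotC z). Qed.

Let dotZr a x y : dot x (a *: y) = a * dot x y.
Proof. by rewrite dotC dotZl dotC. Qed.

Let dot_ge0 x : 0 <= dot x x.
Proof. by have [->|/dot_gt0/ltW//] := eqVneq x 0; rewrite dot0l. Qed.

Let norm_sqr x : norm x ^+ 2 = dot x x.
Proof. by rewrite sqr_sqrtr. Qed.

Let norm_eq0 x : norm x = 0 -> x = 0.
Proof.
by move=> /eqP; rewrite sqrtr_eq0; apply: contraTeq => /dot_gt0; rewrite ltNge.
Qed.

Let normZ a x : norm (a *: x) = `|a| * norm x.
Proof.
by rewrite /norm dotZl dotZr mulrA -expr2 sqrtrM ?sqr_ge0// sqrtr_sqr.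
Qed.

Let cauchy x y : dot x y <= norm x * norm y.
Proof.
have [->|x0] := eqVneq x 0; first by rewrite dot0l mulr_ge0// sqrtr_ge0.
have [->|y0] := eqVneq y 0.
  by rewrite dotC dot0l mulr_ge0// sqrtr_ge0.
have nx : 0 < norm x by rewrite sqrtr_gt0 dot_gt0.
have ny : 0 < norm y by rewrite sqrtr_gt0 dot_gt0.
have := dot_ge0 (norm y *: x + (- norm x) *: y).
rewrite dotDl !dotZl !dotDr !dotZr -!norm_sqr [dot y x]dotC => h.
have {h} : 0 <= 2 * (norm x * norm y) * (norm x * norm y - dot x y).
  by apply: le_trans h _; rewrite le_eqVlt; apply/orP; left; apply/eqP; ring.
by rewrite pmulr_rge0 ?subr_ge0// !mulr_gt0.
Qed.

Let normD x y : norm (x + y) <= norm x + norm y.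
Proof.
rewrite -ler_sqr ?nnegrE ?addr_ge0 ?sqrtr_ge0// norm_sqr.
rewrite dotDl !dotDr (dotC y x) -!norm_sqr.
have := cauchy x y; set d := dot x y; nra.
Qed.

HB.instance Definition _ := Lmodule_isNormed.Build R V normD normZ norm_eq0.

HB.instance Definition _ := NormedVector_isEuclid.Build R V
  dotC dotDl dotZl (fun x => esym (norm_sqr x)).

HB.end.

(* A fresh name for the product type: the normed module structure of the
   library on [U * V] carries the sup norm, not the Hilbert product norm. *)
Definition hprod (R : realType) (U V : euclidType R) : Type := (U * V)%type.

Section hprod.
Context (R : realType) (U V : euclidType R).

HB.instance Definition _ := Vector.copy (hprod U V) (U * V)%type.

Definition hprod_dot (p q : hprod U V) : R := ip p.1 q.1 + ip p.2 q.2.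

Fact hprod_dotC p q : hprod_dot p q = hprod_dot q p.
Proof. by rewrite /hprod_dot ipC [X in _ + X]ipC. Qed.

Fact hprod_dotDl p q r : hprod_dot (p + q) r = hprod_dot p r + hprod_dot q r.
Proof. by rewrite /hprod_dot !ipDl addrACA. Qed.

Fact hprod_dotZl a p q : hprod_dot (a *: p) q = a * hprod_dot p q.
Proof. by rewrite /hprod_dot !ipZl mulrDr. Qed.

Fact hprod_dot_gt0 p : p != 0 -> 0 < hprod_dot p p.
Proof.
move=> p0; rewrite lt_neqAle /hprod_dot !ipxx addr_ge0 ?sqr_ge0// andbT.
rewrite eq_sym paddr_eq0 ?sqr_ge0// !sqrf_eq0 !normr_eq0.
apply: contra p0 => /andP[/eqP p1 /eqP p2].
by rewrite [p]surjective_pairing p1 p2.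
Qed.

HB.instance Definition _ := Vector_isEuclid.Build R (hprod U V)
  hprod_dotC hprod_dotDl hprod_dotZl hprod_dot_gt0.

End hprod.

Section linear_operators.
Context (R : realType).
Implicit Types U V : euclidType R.

Lemma ip_linear U (g : U) : linear (ip g : U -> R^o).
Proof. by move=> a x y; rewrite ipC ipDl ipZl !(ipC g). Qed.

Lemma ip_inj U (g h : U) : (forall x, ip g x = ip h x) -> g = h.
Proof.
move=> gh; apply/eqP; rewrite -subr_eq0 -normr_eq0 -sqrf_eq0 -ipxx.
by rewrite ipDl -scaleN1r ipZl gh mulN1r subrr.
Qed.

Lemma riesz U (phi : 'Hom(U, R^o)) : exists g : U, forall x, phi x = ip g x.
Proof.
pose ipl g : {linear U -> R^o} :=
  HB.pack (ip g : U -> R^o) (GRing.isLinear.Build R U R^o _ _ (ip_linear g)).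
pose j g : 'Hom(U, R^o) := linfun (ipl g).
have jE g x : j g x = ip g x by rewrite lfunE.
have jlin : linear j.
  move=> a g h; apply/lfunP => x.
  by rewrite !(lfunE, jE)/= lfunE/= !jE ipDl ipZl.
pose jl : {linear U -> 'Hom(U, R^o)} :=
  HB.pack j (GRing.isLinear.Build R U 'Hom(U, R^o) _ j jlin).
have /eqP ker0 : lker (linfun jl) == 0%VS.
  rewrite -subv0; apply/subvP => g; rewrite memv_ker lfunE/= => /eqP jg0.
  rewrite memv0; apply/eqP/ip_inj => x.
  by rewrite -jE jg0 lfunE/= -[0 in RHS](scale0r 0) ipZl mul0r.
have /eqP im : limg (linfun jl) == fullv.
  rewrite eqEdim subvf/=; have := limg_ker_dim (linfun jl) fullv.
  rewrite ker0 capv0 dimv0 add0n => ->.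
  by rewrite !dimvf /dim/= muln1.
have /memv_imgP[g _ phiE] : phi \in limg (linfun jl) by rewrite im memvf.
by exists g => x; rewrite phiE lfunE/= jE.
Qed.

Definition adj U V (L : 'Hom(U, V)) : 'Hom(V, U) :=
  xget 0 [set M : 'Hom(V, U) | forall x y, ip (L x) y = ip x (M y)].

Lemma adjP U V (L : 'Hom(U, V)) x y : ip (L x) y = ip x (adj L y).
Proof.
rewrite /adj; set P := (X in xget _ X); move: x y; apply: (@xgetPex _ 0 P).
have adjy y : exists g : U, forall x, ip (L x) y = ip g x.
  have lin : linear (fun x => ip (L x) y : R^o).
    by move=> a x x'; rewrite linearP ipDl ipZl.
  pose l : {linear U -> R^o} := HB.pack (fun x => ip (L x) y : R^o)
    (GRing.isLinear.Build R U R^o _ _ lin).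
  by have [g gE] := riesz (linfun l); exists g => x; rewrite -gE lfunE.
have [m mE] := choice adjy.
have mlin : linear m.
  move=> a y y'; apply: ip_inj => x.
  by rewrite ipDl ipZl -!mE ipC ipDl ipZl !(ipC _ (L x)).
pose M : {linear V -> U} := HB.pack m (GRing.isLinear.Build R V U _ m mlin).
by exists (linfun M) => x y; rewrite lfunE/= mE ipC.
Qed.

Definition opnorm U V (L : 'Hom(U, V)) : R :=
  sup [set `|L x| | x in [set x | `|x| <= 1]].

Definition grad U (f : U -> R) (x : U) : U :=
  xget 0 [set g | forall h, 'd f x h = ip g h].

Lemma gradP U (f : U -> R) x h : 'd f x h = ip (grad f x) h.
Proof.
rewrite /grad; set P := (X in xget _ X); move: h; apply: (@xgetPex _ 0 P).
by have [g gE] := riesz (linfun ('d f x)); exists g => h; rewrite -gE lfunE.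
Qed.

End linear_operators.

Section convex_analysis.
Context (R : realType) (U : euclidType R).
Implicit Types (phi : U -> \bar R) (x u : U) (D : set U).

Definition proper_efun phi :=
  (forall x, phi x != -oo%E) /\ exists x, phi x \is a fin_num.

Definition convex_efun phi := forall (t : R) (x y : U), 0 < t < 1 ->
  (phi (t *: x + (1 - t) *: y)%R <= t%:E * phi x + (1 - t)%R%:E * phi y)%E.

Definition Gamma0 phi :=
  [/\ proper_efun phi, lower_semicontinuous phi & convex_efun phi].

Definition coercive phi :=
  forall M : R, exists r : R, forall x, r <= `|x| -> (M%:E <= phi x)%E.

Definition edom phi : set U := [set x | (phi x < +oo)%E].

Definition conjugate phi u : \bar R :=
  ereal_sup [set ((ip x u)%:E - phi x)%E | x in setT].

(* For a proper [phi] this is empty wherever [phi] takes the value +oo. *)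
Definition subdiff phi x : set U :=
  [set u | forall y, (phi x + (ip (y - x)%R u)%:E <= phi y)%E].

Definition argmin phi : set U := [set x | forall y, (phi x <= phi y)%E].

(* In [prox], [proj] and [emin] below, the first argument of [xget] is only the
   value taken when there is no minimizer. *)
Definition prox phi x : U :=
  xget 0 (argmin (fun v => (phi v + (2^-1 * `|v - x| ^+ 2)%R%:E)%E)).

Definition convex_indic D x : \bar R := if x \in D then 0%E else +oo%E.

Definition proj D x : U :=
  xget 0 [set p | D p /\ forall q, D q -> `|x - p| <= `|x - q|].

Definition Fix (T : U -> U) : set U := [set h | T h = h].

Definition positive_definite (P : U -> U) :=
  (forall x y, ip (P x) y = ip x (P y)) /\ forall x, x != 0 -> 0 < ip (P x) x.

(* Norm of the inner product [<P x, y>], for a positive definite [P]. *)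
Definition normP (P : U -> U) x : R := Num.sqrt (ip (P x) x).

(* Averagedness of [T] with respect to the norm [N]. *)
Definition averaged (N : U -> R) (alpha : R) (T : U -> U) :=
  0 < alpha < 1 /\
  exists2 Q : U -> U, (forall x y, N (Q x - Q y) <= N (x - y)) &
    forall x, T x = (1 - alpha) *: x + alpha *: Q x.

End convex_analysis.

Definition emin (R : realType) (E : set (\bar R)) : \bar R :=
  xget +oo%E [set m | E m /\ forall e, E e -> (m <= e)%E].

(* The generalized Moreau enhanced function of [Psi]. *)
Definition gme (R : realType) (Z Zt : euclidType R) (Psi : Z -> \bar R)
    (B : 'Hom(Z, Zt)) (z : Z) : \bar R :=
  (Psi z -
   emin [set (Psi v + (2^-1 * `|B (z - v)%R| ^+ 2)%R%:E)%E | v in setT])%E.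

Section model.
Context (R : realType) (X Y Z Zt Zf : euclidType R).
Context (A : 'Hom(X, Y)) (f : Y -> R) (Psi : Z -> \bar R) (mu : R).
Context (L : 'Hom(X, Z)) (Delta : set Zf) (C : 'Hom(X, Zf)) (B : 'Hom(Z, Zt)).

Definition cost (x : X) : \bar R := ((f (A x))%:E + mu%:E * gme Psi B (L x))%E.

Definition constraint (x : X) : \bar R := convex_indic Delta (C x).

Definition solutions : set X := [set x | Delta (C x) /\
  forall y, Delta (C y) -> (cost x <= cost y)%E].

Definition smooth (x : X) : R := f (A x) - mu / 2 * `|B (L x)| ^+ 2.

Local Notation H := (hprod (hprod (hprod X Z) Z) Zf).

Definition Xi (h : H) : X := h.1.1.1.

Definition opF (h : H) : H :=
  let: (x, v, _, _) := h in (grad smooth x, mu *: adj B (B v), 0, 0).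

Definition opG (h : H) : set H :=
  let: (x, v, w, z) := h in
  [set mu *: adj L (adj B (B v)) + mu *: adj L w + mu *: adj C z]
  `*` [set - (mu *: adj B (B (L x))) + mu *: s | s in subdiff Psi v]
  `*` [set - (mu *: L x) + mu *: s | s in subdiff (conjugate Psi) w]
  `*` [set - (mu *: C x) + mu *: s
      | s in subdiff (conjugate (convex_indic Delta)) z].

Section algorithm.
Context (sigma tau : R).

Definition opT (h : H) : H :=
  let: (x, v, w, z) := h in
  let xi := x - sigma^-1 *: grad smooth x - (mu / sigma) *: adj L (adj B (B v))
            - (mu / sigma) *: adj L w - (mu / sigma) *: adj C z in
  let zeta := prox (fun u => ((mu / tau)%:E * Psi u)%E)
    ((2 * mu / tau) *: adj B (B (L xi)) - (mu / tau) *: adj B (B (L x))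
     + (v - (mu / tau) *: adj B (B v))) in
  let eta := prox (conjugate Psi) (2 *: L xi - L x + w) in
  let y := 2 *: C xi - C x + z in
  (xi, zeta, eta, y - proj Delta y).

Definition opP (h : H) : H :=
  let: (x, v, w, z) := h in
  (sigma *: x - mu *: adj L (adj B (B v)) - mu *: adj L w - mu *: adj C z,
   - (mu *: adj B (B (L x))) + tau *: v,
   - (mu *: L x) + mu *: w,
   - (mu *: C x) + mu *: z).

Context (rho : R).

Definition normLC : R := opnorm ((adj L \o L)%VF + (adj C \o C)%VF).
Definition normBBL : R := opnorm (adj B \o B \o L)%VF.

Definition stepsize := sigma >
  mu * normLC + (2 * rho * mu ^+ 2 * normBBL ^+ 2 + tau) / (2 * rho * tau - 1).

Definition theta : R := (sigma + tau - mu * normLC) /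
  (rho * (sigma * tau - tau * mu * normLC - mu ^+ 2 * normBBL ^+ 2)).

End algorithm.
End model.

(* Main.v *)
Require Import Defs.
From HB Require Import structures.
From mathcomp Require Import all_boot all_order all_algebra.
From mathcomp Require Import all_classical all_reals all_analysis.
From mathcomp Require Import ring lra.
Import Order.TTheory GRing.Theory Num.Theory.
Import numFieldNormedType.Exports.
Local Open Scope classical_set_scope.
Local Open Scope ring_scope.
Set Implicit Arguments.
Unset Strict Implicit.
Unset Printing Implicit Defensive.

(* The Moreau envelope subtracted in the GME function expands at a point [z] with
   slope [B^* B (z - v)], where [v] is any minimizer, up to a quadratic error.
   So the cost is [mu Psi o L] plus a function with the gradient-like slope
   [grad d + mu L^* B^* B v], and Fermat's rule with the three sum and chain rules
   turns optimality into a system in [(x, v, w, z)]. Since the subdifferential of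
   a conjugate is the inverse of the subdifferential (obtained from the Moreau
   decomposition, without Fenchel-Moreau), this system says both that [F + G]
   vanishes and that [(x, v, w, z)] is a fixed point of [T].

   [T] is the forward-backward step [(P + G)^-1 (P - F)]. By Baillon-Haddad [F] is
   [rho]-cocoercive, and [P] dominates [(theta rho)^-1 (|x|^2 + |v|^2)] on the
   only two components seen by [F]; completing the square in the monotonicity of
   [G] gives averagedness for the norm of [P], and the iterates converge because
   a bounded, asymptotically regular, Fejer monotone sequence has a cluster point
   in the fixed point set. *)

(** * Inner products and linear operators *)

Section inner_product.
Context (R : realType) (U : euclidType R).
Implicit Types (x y z : U) (a : R).

Lemma ipDr x y z : ip x (y + z) = ip x y + ip x z.
Proof. by rewrite ipC ipDl !(ipC x). Qed.

Lemma ipZr a x y : ip x (a *: y) = a * ip x y.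
Proof. by rewrite ipC ipZl ipC. Qed.

Lemma ipNl x y : ip (- x) y = - ip x y.
Proof. by rewrite -scaleN1r ipZl mulN1r. Qed.

Lemma ipNr x y : ip x (- y) = - ip x y.
Proof. by rewrite ipC ipNl ipC. Qed.

Lemma ip0l y : ip 0 y = 0.
Proof. by rewrite -[0 in LHS](scale0r 0) ipZl mul0r. Qed.

Lemma ip0r y : ip y 0 = 0.
Proof. by rewrite ipC ip0l. Qed.

Definition ipE :=
  (@ipDl R U, ipDr, ipNl, ipNr, @ipZl R U, ipZr, ip0l, ip0r).

Lemma ip_ge0 x : 0 <= ip x x.
Proof. by rewrite ipxx sqr_ge0. Qed.

Lemma ip_le_norm x y : ip x y <= `|x| * `|y|.
Proof.
have [->|x0] := eqVneq x 0; first by rewrite ip0l normr0 mul0r.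
have [->|y0] := eqVneq y 0; first by rewrite ip0r normr0 mulr0.
have nx : 0 < `|x| by rewrite normr_gt0.
have ny : 0 < `|y| by rewrite normr_gt0.
have := ip_ge0 (`|y| *: x - `|x| *: y).
rewrite !ipE !ipxx (ipC y x) => h.
have : 0 <= 2 * (`|x| * `|y|) * (`|x| * `|y| - ip x y) by lra.
by rewrite pmulr_rge0 ?subr_ge0// !mulr_gt0.
Qed.

Lemma normr_ip_le x y : `|ip x y| <= `|x| * `|y|.
Proof.
rewrite ler_norml ip_le_norm andbT lerNl -ipNl.
by apply: le_trans (ip_le_norm _ _) _; rewrite normrN.
Qed.

Lemma ip_norm_eq0 x : ip x x <= 0 -> x = 0.
Proof.
move=> h; apply/eqP; rewrite -normr_eq0 -sqrf_eq0 -ipxx eq_le h.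
exact: ip_ge0.
Qed.

End inner_product.

(* Identities between linear combinations, tested against an arbitrary vector. *)
Ltac vec_ring := apply: ip_inj => ?; rewrite !ipE; ring.

Section operators.
Context (R : realType) (U V : euclidType R) (L : 'Hom(U, V)).

Lemma homD x y : L (x + y) = L x + L y. Proof. exact: linearD. Qed.
Lemma homN x : L (- x) = - L x. Proof. exact: linearN. Qed.
Lemma homB x y : L (x - y) = L x - L y. Proof. exact: linearB. Qed.
Lemma homZ a x : L (a *: x) = a *: L x. Proof. exact: linearZ. Qed.
Lemma hom0 : L 0 = 0. Proof. exact: linear0. Qed.

Definition homE := (homD, homN, homZ, hom0).

Lemma adjPr x y : ip y (L x) = ip (adj L y) x.
Proof. by rewrite ipC adjP ipC. Qed.

End operators.

(** * Bounded operators and compactness of balls *)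

Section bounded_operators.
Context (R : realType).
Implicit Types U V : euclidType R.

Lemma functional_bounded U (phi : {linear U -> R^o}) :
  exists2 M : R, 0 <= M & forall x, `|phi x| <= M * `|x|.
Proof.
have [g gE] := riesz (linfun phi); exists `|g| => // x.
by rewrite -[phi x](lfunE phi) gE normr_ip_le.
Qed.

Lemma hom_bounded U V (L : 'Hom(U, V)) :
  exists2 M : R, 0 <= M & forall x, `|L x| <= M * `|x|.
Proof.
pose b := vbasis (fullv : {vspace U}).
have /choice[c cP] (i : 'I_(\dim (fullv : {vspace U}))) :
    exists M : R, forall x, `|coord b i x| <= M * `|x|.
  by have [M _ HM] := functional_bounded (coord b i); exists M.
pose M := \sum_i `|c i| * `|L b`_i|.
exists M => [|x]; first by apply: sumr_ge0 => i _; rewrite mulr_ge0.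
rewrite {1}(coord_vbasis (memvf x)) linear_sum.
apply: le_trans (ler_norm_sum _ _ _) _; rewrite mulr_suml.
apply: ler_sum => i _; rewrite linearZ normrZ mulrAC ler_wpM2r//.
by apply: le_trans (cP i x) _; rewrite ler_wpM2r// ler_norm.
Qed.

Lemma opnorm_ub U V (L : 'Hom(U, V)) x : `|L x| <= opnorm L * `|x|.
Proof.
have [M M0 LM] := hom_bounded L.
have [->|x0] := eqVneq x 0; first by rewrite linear0 !normr0 mulr0.
have nx : 0 < `|x| by rewrite normr_gt0.
rewrite -ler_pdivrMr// mulrC.
have -> : `|x|^-1 * `|L x| = `|L (`|x|^-1 *: x)|.
  by rewrite linearZ normrZ normfV normr_id.
apply: ub_le_sup.
  exists M => _ [y /= y1 <-]; apply: le_trans (LM y) _.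
  by rewrite -[leRHS]mulr1 ler_wpM2l.
by exists (`|x|^-1 *: x) => //=; rewrite normrZ normfV normr_id mulVf// gt_eqF.
Qed.

Lemma opnorm_ge0 U V (L : 'Hom(U, V)) : 0 <= opnorm L.
Proof.
have [M M0 LM] := hom_bounded L.
apply: ub_le_sup.
  exists M => _ [y /= y1 <-]; apply: le_trans (LM y) _.
  by rewrite -[leRHS]mulr1 ler_wpM2l.
by exists 0; rewrite /= ?normr0 ?linear0 ?normr0.
Qed.

Lemma hom_continuous U V (L : 'Hom(U, V)) : continuous L.
Proof.
have [M M0 LM] := hom_bounded L.
apply/linear_bounded_continuous/linear_boundedP.
exists M; split; first exact: num_real.
move=> r /ltW Mr x; apply: le_trans (LM x) _.
by rewrite ler_wpM2r.
Qed.

(** Cauchy-Schwarz applied to [ip (L (adj L y)) y], which is the square of the norm of [adj L y],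
    then division by that norm. *)
Lemma adj_ub U V (L : 'Hom(U, V)) y : `|adj L y| <= opnorm L * `|y|.
Proof.
have [->|/eqP y0] := eqVneq (adj L y) 0.
  by rewrite normr0 mulr_ge0// opnorm_ge0.
have ny : 0 < `|adj L y| by rewrite normr_gt0; apply/eqP.
rewrite -(ler_pM2l ny) -expr2 -ipxx -adjP.
apply: le_trans (ip_le_norm _ _) _; rewrite mulrA ler_wpM2r//.
by rewrite mulrC opnorm_ub.
Qed.

(** The ball is the image, under the linear map [g] sending coordinates to vectors, of a closed set
    of row vectors. That set is bounded because each coordinate is a bounded functional of [g v]. *)
Lemma closed_ball_compact U (r : R) : compact [set x : U | `|x| <= r].
Proof.
pose n := \dim (fullv : {vspace U}).
pose b : n.-tuple U := vbasis (fullv : {vspace U}).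
pose g (v : 'rV[R]_n) : U := \sum_i v 0 i *: b`_i.
have glin : linear g.
  move=> a u v; rewrite /g scaler_sumr -big_split/=; apply: eq_bigr => i _.
  by rewrite !mxE scalerDl scalerA.
pose gl : {linear 'rV[R]_n -> U} :=
  HB.pack g (GRing.isLinear.Build R 'rV[R]_n U _ _ glin).
have gc : continuous g.
  suff : continuous gl by [].
  apply/linear_bounded_continuous/linear_boundedP.
  pose M := \sum_(i < n) `|b`_i|.
  exists M; split; first exact: num_real.
  move=> s /ltW Ms v.
  apply: (@le_trans _ _ (M * `|v|)); last by rewrite ler_wpM2r.
  apply: le_trans (ler_norm_sum _ _ _) _; rewrite mulr_suml.
  apply: ler_sum => i _; rewrite normrZ mulrC ler_wpM2l//.
  rewrite [leRHS]/Num.norm/= mx_normrE; exact: (le_bigmax _ _ (0, i)).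
have gK (x : U) : g (\row_i coord b i x) = x.
  rewrite /g [RHS](coord_vbasis (memvf x)).
  by apply: eq_bigr => i _; rewrite mxE.
have /choice[c cP] (i : 'I_n) : exists c : R, forall v : 'rV[R]_n,
    `|v 0 i| <= c * `|g v|.
  have [m _ mP] := functional_bounded (coord b i); exists m => v.
  have -> : v 0 i = coord b i (g v).
    by rewrite coord_sum_free// (basis_free (vbasisP _)).
  exact: mP.
have -> : [set x : U | `|x| <= r] = g @` (g @^-1` [set x : U | `|x| <= r]).
  by apply/seteqP; split=> [x xr|_ [v vr <-]//]; exists (\row_i coord b i x);
    rewrite /= gK.
apply: continuous_compact; first exact: continuous_subspaceT.
apply: bounded_closed_compact.
  exists (\sum_i `|c i| * `|r|); split; first exact: num_real.
  move=> s /ltW + v /= vr; apply: le_trans.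
  rewrite [leLHS]/Num.norm/= mx_normrE; apply/bigmax_leP; split=> [|[i j] _] /=.
    by apply: sumr_ge0 => i _; rewrite mulr_ge0.
  rewrite ord1 (bigD1 j)//=.
  apply: le_trans (cP j _) _; apply: (@le_trans _ _ (`|c j| * `|r|)).
    apply: le_trans (ler_norm _) _; rewrite normrM normr_id ler_wpM2l//.
    by apply: le_trans vr _; rewrite ler_norm.
  by rewrite lerDl; apply: sumr_ge0 => k _; rewrite mulr_ge0.
apply: closed_comp; first by move=> ? _; exact: gc.
by apply: (@closed_comp _ _ (fun x : U => `|x|) [set y | y <= r]) => [? _|];
  [exact: norm_continuous|exact: closed_le].
Qed.

End bounded_operators.

(** * Minimizers and subgradients *)

Section minimizers.
Context (R : realType) (U : euclidType R).
Implicit Types (phi : U -> \bar R) (q : U -> R) (x y p g : U).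

Lemma ereal_dense_fin (a b : \bar R) : (a < b)%E ->
  exists r : R, (a < r%:E < b)%E.
Proof.
case: a => [a| |]; case: b => [b| |] //.
- rewrite lte_fin => ab; exists ((a + b) / 2); rewrite !lte_fin; lra.
- by move=> _; exists (a + 1); rewrite ltry lte_fin ltrDl ltr01.
- by move=> _; exists (b - 1); rewrite ltNyr lte_fin gtrBl ltr01.
- by move=> _; exists 0; rewrite ltNyr ltry.
Qed.

(** A real [b] strictly between [a - q x] and [phi x] splits the threshold: near [x], [phi] stays
    above [b] and [q] above [a - b]. *)
Lemma lower_semicontinuousD phi q : lower_semicontinuous phi -> continuous q ->
  lower_semicontinuous (fun x => (phi x + (q x)%:E)%E).
Proof.
move=> lphi cq x a; rewrite -lteBlDr// => /ereal_dense_fin[b /andP[ab bphi]].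
have [V Vx Vb] := lphi x b bphi.
have abx : a - b < q x by move: ab; rewrite -EFinB lte_fin; lra.
exists (V `&` [set y | a - b < q y]).
  by apply: filterI => //; exact: (cvgr_gt (q x) (cq x)).
move=> y [/Vb by_ /= aby]; rewrite -lteBlDr//.
by apply: le_lt_trans by_; rewrite -EFinB lee_fin; lra.
Qed.

(** By contradiction. Strict sublevel sets inside a large ball form a proper filter, which clusters
    at some [p] by compactness. With no minimizer, some level of the filter lies below [phi p],
    against lower semicontinuity at [p]. *)
Lemma argmin_coercive phi : lower_semicontinuous phi -> coercive phi ->
  (exists x, phi x \is a fin_num) -> argmin phi !=set0.
Proof.
move=> lphi cphi [x0 /fineK x0fin]; set r0 := fine (phi x0) in x0fin.
have [r rP] := cphi r0.
pose K := [set x : U | `|x| <= Num.max r `|x0|].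
have K0 : K x0 by rewrite /K/= le_max lexx orbT.
have KP x : ~ K x -> (phi x0 <= phi x)%E.
  move=> /negP; rewrite -ltNge gt_max => /andP[/ltW rx _].
  by rewrite -x0fin; exact: rP.
apply: contrapT => noargmin.
pose D := [set a : R | exists2 y, K y & (phi y < a%:E)%E].
(* Since [p] is not a minimizer, a level strictly below [phi p] is still undercut inside [K];
   outside [K], coercivity lets [x0] serve as the witness. *)
have DP p : exists2 a, D a & (a%:E < phi p)%E.
  have [y yp] : exists y, (phi y < phi p)%E.
    apply: contrapT => hp; apply: noargmin; exists p => y.
    by rewrite leNgt; apply/negP => yp; apply: hp; exists y.
  have [Ky|/KP x0y] := pselect (K y).
    by have [a /andP[ya ap]] := ereal_dense_fin yp; exists a => //; exists y.
  have [a /andP[ya ap]] := ereal_dense_fin (le_lt_trans x0y yp).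
  by exists a => //; exists x0.
pose F := filter_from D (fun a => K `&` [set y | (phi y < a%:E)%E]).
have FF : ProperFilter F.
  apply: filter_from_proper; last by move=> a [y Ky ya]; exists y.
  apply: filter_from_filter.
    by have [a Da _] := DP x0; exists a.
  move=> a b [y Ky ya] [z Kz zb].
  have [ab|ba] := leP a b.
    exists a; first by exists y.
    by move=> w [Kw /= wa]; do 2?split => //=; apply: lt_le_trans wa _.
  exists b; first by exists z.
  move=> w [Kw /= wb]; do 2?split => //=; apply: lt_le_trans wb _.
  by rewrite lee_fin ltW.
have FK : F K.
  by have [a Da _] := DP x0; exists a => // w [].
have [p [Kp pF]] := closed_ball_compact FF FK.
have [a Da ap] := DP p.
have [V Vp Va] := lphi p a ap.
have FDa : F (K `&` [set y | (phi y < a%:E)%E]) by exists a.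
have [z [[_ /= za] /Va az]] := pF _ _ FDa Vp.
by move: (lt_trans za az); rewrite ltxx.
Qed.

(** The limit as [t] tends to 0, made explicit: if [D] were negative, a [t] with [t * (|c| + 1)] at
    most [- D / 2] would contradict the hypothesis. *)
Lemma ge0_of_affine_ge0 (D c : R) : (forall t, 0 < t < 1 -> 0 <= D + t * c) ->
  0 <= D.
Proof.
move=> h; rewrite leNgt; apply/negP => D0.
have c0 : 0 < `|c| + 1 by rewrite ltr_pwDr.
pose t := Num.min (1 / 2) (- D / (2 * (`|c| + 1))).
have t0 : 0 < t by rewrite /t lt_min !divr_gt0 ?oppr_gt0 ?mulr_gt0.
have t1 : t < 1 by rewrite /t gt_min; apply/orP; left; lra.
have : t * (`|c| + 1) <= - D / 2.
  apply: (@le_trans _ _ (- D / (2 * (`|c| + 1)) * (`|c| + 1))).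
    by rewrite ler_wpM2r /t ?ge_min ?lexx ?orbT ?ltW.
  by rewrite le_eqVlt; apply/orP; left; apply/eqP; field; exact: lt0r_neq0.
have := h t; rewrite t0 t1 => /(_ isT).
have : t * c <= t * `|c| by rewrite ler_wpM2l ?ler_norm// ltW.
lra.
Qed.

(* First-order optimality: [q] only needs an upper expansion along segments,
   with slope [g], at the minimizer. *)
Lemma argmin_subdiff phi q p g : proper_efun phi -> convex_efun phi ->
  (forall y, exists c, forall t, 0 < t < 1 ->
    q (t *: y + (1 - t) *: p) <= q p + t * ip (y - p) g + t ^+ 2 * c) ->
  argmin (fun x => (phi x + (q x)%:E)%E) p -> subdiff phi p (- g).
Proof.
move=> [phiNy [x0 x0fin]] cphi qP pmin.
have ltpy : (phi p < +oo)%E.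
  have := pmin x0; rewrite -(fineK x0fin) -EFinD.
  by move: (phiNy p); case: (phi p) => [r _ _|_|]//; rewrite ?ltry// leye_eq.
have pfin : phi p \is a fin_num by rewrite fin_numE phiNy lt_eqF.
move=> y; have [->|yfin] := eqVneq (phi y) +oo%E; first by rewrite leey.
have {}yfin : phi y \is a fin_num by rewrite fin_numE phiNy.
rewrite -(fineK pfin) -(fineK yfin) -EFinD lee_fin ipNr.
rewrite -subr_ge0; have [c cP] := qP y.
apply: (@ge0_of_affine_ge0 _ c) => t t01; have /andP[t0 t1] := t01.
have := pmin (t *: y + (1 - t) *: p).
have := cphi t y p t01; have := cP t t01.
move: (phiNy (t *: y + (1 - t) *: p)).
rewrite -(fineK pfin) -(fineK yfin); set fp := fine (phi p).
set fy := fine (phi y); set qt := q _.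
rewrite -!EFinM -!EFinD; case: (phi _) => [ft| |] _ //.
rewrite -!EFinD !lee_fin => h1 h2 h3.
have : 0 <= t * (fy - (fp - ip (y - p) g) + t * c) by lra.
by rewrite pmulr_rge0.
Qed.

Lemma subdiff_fin phi x u : proper_efun phi -> subdiff phi x u ->
  phi x \is a fin_num.
Proof.
move=> [phiNy [x0 x0fin]] /(_ x0); rewrite -(fineK x0fin).
by move: (phiNy x); case: (phi x).
Qed.

Lemma subdiff_monotone phi x y u v : proper_efun phi ->
  subdiff phi x u -> subdiff phi y v -> 0 <= ip (x - y) (u - v).
Proof.
move=> pphi ux vy; have := ux y; have := vy x.
rewrite -(fineK (subdiff_fin pphi ux)) -(fineK (subdiff_fin pphi vy)).
by rewrite -!EFinD !lee_fin !ipE; lra.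
Qed.

Lemma subdiff_scale phi (c : R) x u : 0 < c ->
  subdiff (fun y => (c%:E * phi y)%E) x (c *: u) <-> subdiff phi x u.
Proof.
by move=> c0; split=> h y; have := h y;
  rewrite ipZr EFinM -muleDr// ?lee_pmul2l// fin_num_adde_defl.
Qed.

Lemma proper_scale phi (c : R) : 0 < c -> proper_efun phi ->
  proper_efun (fun y => (c%:E * phi y)%E).
Proof.
move=> c0 [phiNy [x xfin]]; split=> [y|].
  move: (phiNy y); case: (phi y) => [r| |] // _.
  by rewrite gt0_muley// lte_fin.
by exists x; rewrite fin_numM.
Qed.

Lemma convex_scale phi (c : R) : 0 < c -> proper_efun phi -> convex_efun phi ->
  convex_efun (fun y => (c%:E * phi y)%E).
Proof.
move=> c0 [phiNy _] cphi t x y t01; have /andP[t0 t1] := t01.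
have nNy (s : R) z : 0 < s -> (s%:E * phi z)%E != -oo%E.
  by move=> s0; move: (phiNy z); case: (phi z) => [r| |] // _;
    rewrite gt0_muley ?lte_fin.
have := cphi t x y t01.
rewrite !(muleCA _ c%:E) -muleDr//; first by rewrite lee_pmul2l.
by rewrite /adde_def !negb_and !nNy ?subr_gt0// !orbT.
Qed.

Lemma lower_semicontinuous_scale phi (c : R) : 0 < c ->
  lower_semicontinuous phi -> lower_semicontinuous (fun y => (c%:E * phi y)%E).
Proof.
move=> c0 lphi x a; rewrite -lte_pdivrMl// -EFinM => /(lphi _ _)[V Vx VP].
by exists V => // y /VP; rewrite EFinM lte_pdivrMl.
Qed.

Lemma coercive_scale phi (c : R) : 0 < c -> coercive phi ->
  coercive (fun y => (c%:E * phi y)%E).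
Proof.
move=> c0 cphi M; have [r rP] := cphi (c^-1 * M); exists r => x /rP.
by rewrite EFinM lee_pdivrMl.
Qed.

Lemma coerciveD phi q : coercive phi -> (forall x, 0 <= q x) ->
  coercive (fun x => (phi x + (q x)%:E)%E).
Proof.
by move=> cphi q0 M; have [r rP] := cphi M; exists r => x /rP h;
  rewrite -[leLHS]adde0 leeD// lee_fin.
Qed.

End minimizers.

(** * Proximity operators and conjugate functions *)

Section proximity.
Context (R : realType) (U : euclidType R).
Implicit Types (phi : U -> \bar R) (x y z p u v w : U).

(** Minty's surjectivity condition: [Id] plus the subdifferential is onto. Together with properness,
    it is what the conjugation lemmas below rely on. *)
Definition resolvable phi := forall x, exists p, subdiff phi p (x - p).

(** Strong convexity of the proximal objective: its growth away from [p] is quadratic, which yields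
    both minimality and uniqueness. *)
Lemma subdiff_argmin_prox phi x p y : proper_efun phi ->
  subdiff phi p (x - p) ->
  (phi p + (2^-1 * `|p - x| ^+ 2)%:E + (2^-1 * `|y - p| ^+ 2)%:E <=
   phi y + (2^-1 * `|y - x| ^+ 2)%:E)%E.
Proof.
move=> pphi hp; have pfin := subdiff_fin pphi hp.
have [->|yfin] := eqVneq (phi y) +oo%E; first by rewrite addye// leey.
have {}yfin : phi y \is a fin_num by rewrite fin_numE yfin andbT; case: pphi.
have := hp y; rewrite -(fineK pfin) -(fineK yfin) -!EFinD !lee_fin.
have -> : y - x = (y - p) + (p - x) by rewrite addrA subrK.
by rewrite -!ipxx !ipE !(ipC x) !(ipC p); lra.
Qed.

Lemma subdiff_prox phi x p : proper_efun phi -> subdiff phi p (x - p) ->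
  prox phi x = p.
Proof.
move=> pphi hp; have pfin := subdiff_fin pphi hp.
have pmin : argmin (fun v => (phi v + (2^-1 * `|v - x| ^+ 2)%:E)%E) p.
  move=> y; apply: le_trans (subdiff_argmin_prox y pphi hp).
  by rewrite leeDl// lee_fin mulr_ge0// sqr_ge0.
have := subdiff_argmin_prox (prox phi x) pphi hp => /le_trans.
move=> /(_ _ (xgetPex 0 (ex_intro _ p pmin) p)).
rewrite -(fineK pfin) -!EFinD lee_fin gerDl.
rewrite pmulr_rle0// => h; apply/eqP; rewrite -subr_eq0 -normr_eq0 -sqrf_eq0.
by rewrite eq_le h sqr_ge0.
Qed.

Lemma prox_subdiff phi x p : proper_efun phi -> resolvable phi ->
  prox phi x = p <-> subdiff phi p (x - p).
Proof.
move=> pphi rphi; split; last exact: subdiff_prox.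
by have [q hq] := rphi x; rewrite (subdiff_prox pphi hq) => <-.
Qed.

(** The point is a minimizer of the proximal objective, by Fermat's rule. Coercivity is asked of the
    sum so that indicators are covered too. *)
Lemma Gamma0_resolvable phi : Gamma0 phi ->
  (forall x, coercive (fun v => (phi v + (2^-1 * `|v - x| ^+ 2)%:E)%E)) ->
  resolvable phi.
Proof.
move=> [pphi lphi cphi] cophi x; pose q v := 2^-1 * `|v - x| ^+ 2.
have qc : continuous q.
  have nc : continuous (fun v => `|v - x|).
    by move=> v; apply: cvg_norm; apply: cvgB => //; exact: cvg_cst.
  move=> v; apply: cvgM; first exact: cvg_cst.
  by apply: cvgM; exact: nc.
have [|p pmin] := argmin_coercive (lower_semicontinuousD lphi qc) (cophi x).
  by have [_ [x0 x0fin]] := pphi; exists x0; rewrite /= fin_numD x0fin.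
exists p; rewrite -opprB; apply: argmin_subdiff pmin => // y.
exists (2^-1 * `|y - p| ^+ 2) => t _; rewrite /q.
have -> : t *: y + (1 - t) *: p - x = (p - x) + t *: (y - p).
  by vec_ring.
by rewrite -!ipxx !ipE !(ipC x) !(ipC p); lra.
Qed.

Lemma coercive_resolvable phi : Gamma0 phi -> coercive phi -> resolvable phi.
Proof.
move=> gphi cphi; apply: Gamma0_resolvable => // x.
by apply: coerciveD => // v; rewrite mulr_ge0// sqr_ge0.
Qed.

Lemma Gamma0_scale phi (c : R) : 0 < c -> Gamma0 phi ->
  Gamma0 (fun y => (c%:E * phi y)%E).
Proof.
move=> c0 [pphi lphi cphi]; split; first exact: proper_scale.
  exact: lower_semicontinuous_scale.
exact: convex_scale.
Qed.

Lemma conjugate_ge phi x u : ((ip x u)%:E - phi x <= conjugate phi u)%E.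
Proof. by apply: ereal_sup_ubound; exists x. Qed.

(** Equality case of Fenchel-Young: the subgradient inequality says that the supremum is attained at
    [x]. *)
Lemma conjugateE phi x u : proper_efun phi -> subdiff phi x u ->
  conjugate phi u = ((ip x u)%:E - phi x)%E.
Proof.
move=> pphi hx; have xfin := subdiff_fin pphi hx.
apply/eqP; rewrite eq_le conjugate_ge andbT; apply: ge_ereal_sup => _ [y _ <-].
have [->|yfin] := eqVneq (phi y) +oo%E; first by rewrite addeNy leNye.
have {}yfin : phi y \is a fin_num by rewrite fin_numE yfin andbT; case: pphi.
have := hx y; rewrite -(fineK xfin) -(fineK yfin) -!EFinB !lee_fin !ipE; lra.
Qed.

Lemma subdiff_conjugateI phi x u : proper_efun phi -> subdiff phi x u ->
  subdiff (conjugate phi) u x.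
Proof.
move=> pphi hx v; rewrite (conjugateE pphi hx).
apply: le_trans (conjugate_ge phi x v).
rewrite -(fineK (subdiff_fin pphi hx)) -!EFinB -EFinD lee_fin !ipE.
by rewrite !(ipC x); lra.
Qed.

Lemma proper_conjugate phi : proper_efun phi -> resolvable phi ->
  proper_efun (conjugate phi).
Proof.
move=> pphi rphi; have [p hp] := rphi 0; split=> [u|].
  have [phiNy [x xfin]] := pphi; rewrite gt_eqF//.
  apply: lt_le_trans (conjugate_ge phi x u).
  by rewrite -(fineK xfin) -EFinB ltNyr.
exists (0 - p); rewrite (conjugateE pphi hp).
by rewrite -(fineK (subdiff_fin pphi hp)).
Qed.

(* Moreau decomposition: the resolvents of a subdifferential and of its inverse
   add up to the identity. *)
Lemma resolvable_conjugate phi : proper_efun phi -> resolvable phi ->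
  resolvable (conjugate phi).
Proof.
move=> pphi rphi x; have [p hp] := rphi x; exists (x - p).
by rewrite subKr; exact: subdiff_conjugateI.
Qed.

(** For the direct implication, let [p] be the resolvent point of [phi] at [u + w]. Both [w] and
    [u + w - p] are the proximal point of the conjugate at [u + w]; uniqueness gives [p = u]. *)
Lemma subdiff_conjugate phi u w : proper_efun phi -> resolvable phi ->
  subdiff (conjugate phi) w u <-> subdiff phi u w.
Proof.
move=> pphi rphi; split; last exact: subdiff_conjugateI.
move=> hw; have pc := proper_conjugate pphi rphi.
have [p hp] := rphi (u + w).
have w1 : prox (conjugate phi) (u + w) = w.
  by apply: subdiff_prox; rewrite // addrK.
have w2 : prox (conjugate phi) (u + w) = u + w - p.
  by apply: subdiff_prox; rewrite // subKr; exact: subdiff_conjugateI.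
have wE : w = u + w - p by rewrite -w2 w1.
have pE : p = u by apply: (addIr w); rewrite {1}wE addrC subrK.
by rewrite -wE pE in hp.
Qed.

End proximity.

Section projection.
Context (R : realType) (U : euclidType R) (D : set U).
Hypotheses (D0 : D !=set0) (Dcl : closed D)
  (Dconv : convex_set (D : set (convex_lmodType U))).

Let iota := convex_indic D.

Lemma indicT x : D x -> iota x = 0%E.
Proof. by move=> Dx; rewrite /iota /convex_indic mem_set. Qed.

Lemma indicF x : ~ D x -> iota x = +oo%E.
Proof. by move=> Dx; rewrite /iota /convex_indic memNset. Qed.

Lemma indic_Gamma0 : Gamma0 iota.
Proof.
split.
- split=> [x|]; first by rewrite /iota /convex_indic; case: ifP.
  by have [x Dx] := D0; exists x; rewrite indicT.
- move=> x a; have [Dx|nDx] := pselect (D x).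
    rewrite indicT// lte_fin => a0; exists setT; first exact: filterT.
    move=> y _; rewrite /iota /convex_indic; case: ifP => _.
      by rewrite lte_fin.
    exact: ltry.
  move=> _; exists (~` D).
    by apply: open_nbhs_nbhs; split=> //; exact: closed_openC.
  by move=> y nDy; rewrite indicF// ltry.
- move=> t x y /andP[t0 t1].
  have [Dx|nDx] := pselect (D x); last first.
    rewrite (indicF nDx) gt0_muley ?lte_fin// addye ?leey//.
    rewrite /iota /convex_indic; case: ifP; rewrite ?mule0//.
    by rewrite gt0_muley ?lte_fin ?subr_gt0.
  have [Dy|nDy] := pselect (D y); last first.
    rewrite (indicF nDy) gt0_muley ?lte_fin ?subr_gt0//.
    by rewrite (indicT Dx) mule0 add0e leey.
  rewrite (indicT Dx) (indicT Dy) !mule0 adde0 indicT//.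
  have t01 : 0 <= t <= 1 by rewrite !ltW.
  by have := Dconv (Itv01 (ltW t0) (ltW t1)) (mem_set Dx) (mem_set Dy); rewrite inE.
Qed.

Lemma indic_resolvable : resolvable iota.
Proof.
apply: Gamma0_resolvable; first exact: indic_Gamma0.
(* Beyond this radius [v] is at distance at least [2 * |M| + 1] from [x], so the quadratic term
   alone exceeds [M]. *)
move=> x M; exists (`|x| + 2 * `|M| + 1) => v hv.
have h1 : 2 * `|M| + 1 <= `|v - x|.
  by have := lerB_normD v x; have := lerB_dist v x; lra.
have h2 : M <= 2^-1 * `|v - x| ^+ 2 by have := ler_norm M; nra.
rewrite -[leLHS]add0e leeD ?lee_fin//.
by rewrite /iota /convex_indic; case: ifP.
Qed.

(** Both sides choose from the same set of minimizers with the same default value, so the choices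
    agree. *)
Lemma projE x : Defs.proj D x = prox iota x.
Proof.
rewrite /Defs.proj /prox; congr xget; apply/seteqP; split=> p /=.
  move=> [Dp pP] v; rewrite indicT// add0e.
  have [Dv|nDv] := pselect (D v); last by rewrite indicF// addye// leey.
  by rewrite indicT// add0e lee_fin ler_pM2l// ler_sqr ?nnegrE// !(distrC _ x) pP.
move=> pmin; have [x0 Dx0] := D0.
have Dp : D p.
  apply: contrapT => nDp; have := pmin x0.
  by rewrite indicF// indicT// addye// add0e leye_eq.
split=> // q Dq; have := pmin q; rewrite !indicT// !add0e lee_fin ler_pM2l//.
by rewrite ler_sqr ?nnegrE// !(distrC x).
Qed.

End projection.

(** * The Moreau envelope of the enhancement *)

Section moreau_enhancement.
Context (R : realType) (Z Zt : euclidType R) (Psi : Z -> \bar R).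
Context (B : 'Hom(Z, Zt)).
Hypotheses (GPsi : Gamma0 Psi) (cPsi : coercive Psi).
Implicit Types (z v : Z).

(** Taking [fine] loses nothing: the minimum is attained and finite by [envelope_attained] and
    [emin_envelope]. *)
Definition envelope z : R := fine
  (emin [set (Psi v + (2^-1 * `|B (z - v)%R| ^+ 2)%R%:E)%E | v in setT]).

(** Coercivity of [Psi] gives a minimizer [v], recorded through its optimality condition, which is
    the form used from here on. *)
Lemma envelope_attained z : exists v, subdiff Psi v (adj B (B (z - v))).
Proof.
have [pPsi lPsi convPsi] := GPsi; pose q v := 2^-1 * `|B (z - v)| ^+ 2.
have qc : continuous q.
  have nc : continuous (fun v => `|B (z - v)|).
    move=> v; apply: cvg_norm; apply: continuous_cvg; first exact: hom_continuous.
    by apply: cvgB => //; exact: cvg_cst.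
  move=> v; apply: cvgM; first exact: cvg_cst.
  by apply: cvgM; exact: nc.
have coq : coercive (fun v => (Psi v + (q v)%:E)%E).
  by apply: coerciveD => // v; rewrite mulr_ge0// sqr_ge0.
have [|v vmin] := argmin_coercive (lower_semicontinuousD lPsi qc) coq.
  by have [_ [x0 x0fin]] := pPsi; exists x0; rewrite /= fin_numD x0fin.
exists v; rewrite -[adj B _]opprK; apply: argmin_subdiff vmin => // y.
exists (2^-1 * `|B (y - v)| ^+ 2) => t _; rewrite /q.
have -> : z - (t *: y + (1 - t) *: v) = (z - v) - t *: (y - v) by vec_ring.
rewrite (homB B (z - v)) homZ ipNr -adjP -!ipxx.
move: (B (y - v)) (B (z - v)) => a b.
by rewrite !ipE (ipC a b); lra.
Qed.

Lemma emin_envelope z v : subdiff Psi v (adj B (B (z - v))) ->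
  emin [set (Psi v + (2^-1 * `|B (z - v)%R| ^+ 2)%R%:E)%E | v in setT] =
  (Psi v + (2^-1 * `|B (z - v)| ^+ 2)%:E)%E.
Proof.
move=> hv; have [pPsi _ _] := GPsi; have vfin := subdiff_fin pPsi hv.
set E := (X in emin X); set m := (X in _ = X).
have mP : E m /\ forall e, E e -> (m <= e)%E.
  split; first by exists v.
  move=> _ [w _ <-]; rewrite /m.
  have [->|wfin] := eqVneq (Psi w) +oo%E; first by rewrite addye// leey.
  have {}wfin : Psi w \is a fin_num by rewrite fin_numE wfin andbT; case: pPsi.
  have := hv w; rewrite -(fineK vfin) -(fineK wfin) -!EFinD !lee_fin -adjP.
  have -> : z - w = (z - v) - (w - v) by vec_ring.
  rewrite (homB B (z - v)) -!ipxx.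
  move: (B (w - v)) (B (z - v)) => b c.
  by have := ip_ge0 b; rewrite !ipE (ipC b c); lra.
rewrite /emin; set Q := (X in xget _ X).
have [Ee eP] : Q (xget +oo%E Q) by apply: xgetPex; exists m.
by apply/le_anti; rewrite eP ?(mP.2)//; exact: mP.1.
Qed.

Lemma gmeE z : gme Psi B z = (Psi z - (envelope z)%:E)%E.
Proof.
rewrite /gme /envelope; have [v hv] := envelope_attained z.
have [pPsi _ _] := GPsi; have vfin := subdiff_fin pPsi hv.
by rewrite (emin_envelope hv) fineK// fin_numD vfin.
Qed.

(** The lower bound is the subgradient inequality at [v] tested at [v'], the upper one that at [v']
    tested at [v]. The slacks are half the squares of [p' - p] and of [w], in the notation of the
    last lines. *)
Lemma envelope_bounds z z' v : subdiff Psi v (adj B (B (z - v))) ->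
  envelope z + ip (z' - z) (adj B (B (z - v))) <= envelope z' <=
  envelope z + ip (z' - z) (adj B (B (z - v))) + 2^-1 * `|B (z' - z)| ^+ 2.
Proof.
move=> hv; have [v' hv'] := envelope_attained z'.
have [pPsi _ _] := GPsi.
have vfin := subdiff_fin pPsi hv; have vfin' := subdiff_fin pPsi hv'.
rewrite /envelope (emin_envelope hv) (emin_envelope hv').
have := hv v'; have := hv' v; rewrite -(fineK vfin) -(fineK vfin') -!EFinD/=.
rewrite !lee_fin -!adjP -!ipxx.
set a := fine _; set a' := fine _.
have -> : z' - z = (z' - v') - (z - v) + (v' - v) by vec_ring.
have -> : v - v' = - (v' - v) by vec_ring.
rewrite !(homD B (z' - v' - (z - v))) (homB B (z' - v')) (homN B (v' - v)).
move: (B (z - v)) (B (z' - v')) (B (v' - v)) => p p' w.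
have := ip_ge0 w; have := ip_ge0 (p' - p).
by rewrite !ipE (ipC p' p) (ipC w p) (ipC w p'); lra.
Qed.

End moreau_enhancement.

(** * Convex functions with Lipschitz gradient *)

Section smooth_convex.
Context (R : realType) (U : euclidType R).
Implicit Types (d : U -> R) (g : U -> U) (x y h : U) (b c : R).

(** A quadratic remainder is [o(h)], so [ip l] is the differential. *)
Lemma differentiable_quadratic d x (l : U) c :
  (forall h, `|d (h + x) - d x - ip l h| <= c * `|h| ^+ 2) ->
  differentiable d x.
Proof.
move=> dP; pose ipl : {linear U -> R^o} :=
  HB.pack (ip l : U -> R^o) (GRing.isLinear.Build R U R^o _ _ (ip_linear l)).
have iplc : continuous ipl.
  apply/linear_bounded_continuous/linear_boundedP.
  exists `|l|; split; first exact: num_real.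
  by move=> r /ltW lr h; apply: le_trans (normr_ip_le _ _) _; rewrite ler_wpM2r.
have dE : d \o shift x = cst (d x) + ipl +o_ (0 : U) id.
  apply/eqaddoP => e e0; apply/nbhs_normP; exists (e / (`|c| + 1)) => /=.
    by rewrite divr_gt0// ltr_pwDr.
  move=> h; rewrite /= sub0r normrN ltr_pdivlMr ?ltr_pwDr// => he.
  rewrite !fctE/= opprD addrA; apply: le_trans (dP h) _.
  rewrite expr2 mulrA ler_wpM2r//; apply: le_trans (ltW he).
  by rewrite mulrC ler_wpM2l// (le_trans (ler_norm c))// lerDl.
by apply/diff_locallyP; rewrite (diff_unique iplc dE).
Qed.

(** By convexity the difference quotients from the right along [y - x] are at most [d y - d x]; the
    bound passes to the limit. *)
Lemma convex_grad_le d x y : convex_efun (fun z => (d z)%:E) ->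
  differentiable d x -> d x + ip (grad d x) (y - x) <= d y.
Proof.
move=> cd dd; have dv : derivable d x (y - x) by exact: diff_derivable.
rewrite -gradP -deriveE// -lerBrDl.
have dr : h^-1 *: (d (h *: (y - x) + x) - d x) @[h --> 0^'+] -->
    'D_(y - x) d x.
  by apply: cvg_dnbhs_at_right; exact: dv.
apply: (cvgr_to_le dr).
near=> t; have t0 : 0 < t by near: t; exact: nbhs_right_gt.
have t1 : t < 1 by near: t; exact: nbhs_right_lt.
have := cd t y x; rewrite t0 t1 => /(_ isT).
rewrite -!EFinM -EFinD lee_fin.
have -> : t *: y + (1 - t) *: x = t *: (y - x) + x.
  by rewrite scalerBl scale1r scalerBr addrCA addrC.
by move=> dt; rewrite /GRing.scale/= ler_pdivrMl//; lra.
Unshelve. all: by end_near. Qed.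

Section lipschitz_gradient.
Variables (d : U -> R) (g : U -> U) (b : R).
Hypothesis dg : forall x y, d x + ip (g x) (y - x) <= d y.
Hypothesis b0 : 0 < b.
Hypothesis gb : forall x y, `|g x - g y| <= b * `|x - y|.

(* Splitting a step into two halves turns the bound with constant [c] into the
   one with constant [c / 2 + b / 4], whose fixed point is [b / 2]. *)
Lemma descent_halving c :
  (forall x h, d (x + h) <= d x + ip (g x) h + c * `|h| ^+ 2) ->
  forall x h, d (x + h) <= d x + ip (g x) h + (c / 2 + b / 4) * `|h| ^+ 2.
Proof.
move=> dc x h; pose k := 2^-1 *: h.
have hk : h = k + k by rewrite -mulr2n -scaler_nat scalerA divff// scale1r.
have nk : `|h| = 2 * `|k|.
  by rewrite hk -mulr2n -scaler_nat normrZ ger0_norm.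
have := dc (x + k) k; have := dc x k.
have : ip (g (x + k) - g x) k <= b * `|k| * `|k|.
  apply: le_trans (ip_le_norm _ _) _; rewrite ler_wpM2r//.
  by apply: le_trans (gb _ _) _; rewrite addrAC subrr add0r.
by rewrite nk {1 2}hk addrA !ipE; lra.
Qed.

(** The gradient inequality at [y + k] gives the bound with constant [b]; each halving divides the
    excess over [b / 2] by two, and the bound passes to the limit. *)
Lemma descent x h : d (x + h) <= d x + ip (g x) h + b / 2 * `|h| ^+ 2.
Proof.
have dn n y k :
    d (y + k) <= d y + ip (g y) k + (b / 2 + b / 2 / 2 ^+ n) * `|k| ^+ 2.
  elim: n y k => [|n IH] y k.
    have : ip (g (y + k) - g y) k <= b * `|k| * `|k|.
      apply: le_trans (ip_le_norm _ _) _; rewrite ler_wpM2r//.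
      by apply: le_trans (gb _ _) _; rewrite addrAC subrr add0r.
    have := dg (y + k) y; rewrite opprD addNKr expr0 divr1 !ipE; lra.
  apply: le_trans (descent_halving IH y k) _; rewrite lerD2l ler_wpM2r//.
  by rewrite exprS le_eqVlt; apply/orP; left; apply/eqP; field; rewrite expf_neq0.
set a := d x + _ + _; set e := b / 2 * `|h| ^+ 2 in a *.
have ea : a + e * 2^-1 ^+ n @[n --> \oo] --> a.
  rewrite -[X in _ --> X]addr0; apply: cvgD; first exact: cvg_cst.
  rewrite -[X in _ --> X](mulr0 e); apply: cvgM; first exact: cvg_cst.
  by apply: cvg_expr; rewrite ger0_norm; lra.
apply: (cvgr_to_ge ea).
by near=> n; apply: le_trans (dn n x h) _; rewrite /a /e -exprVn; lra.
Unshelve. all: by end_near. Qed.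

(* Baillon-Haddad: compare the gradient inequality at [x] with the descent
   inequality at [y], both at the point reached from [y] by a gradient step. *)
Lemma cocoercive_grad x y :
  `|g x - g y| ^+ 2 <= b * ip (g x - g y) (x - y).
Proof.
have half u v : d v + ip (g v) (u - v) + (2 * b)^-1 * `|g u - g v| ^+ 2 <= d u.
  (* This [k] minimizes [ip (g u - g v) k + b / 2 * |k| ^+ 2], whose minimum is the term with
     constant [(2 * b)^-1], up to sign. *)
  pose k := b^-1 *: (g v - g u).
  have := dg v (u + k); have := descent u k.
  have -> : `|k| ^+ 2 = b^-1 ^+ 2 * `|g u - g v| ^+ 2.
    by rewrite normrZ exprMn distrC ger0_norm// invr_ge0 ltW.
  have : ip (g v - g u) k = b^-1 * `|g u - g v| ^+ 2.
    by rewrite ipZr ipxx distrC.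
  have -> : b / 2 * (b^-1 ^+ 2 * `|g u - g v| ^+ 2) =
      2^-1 * (b^-1 * `|g u - g v| ^+ 2) by field; exact: lt0r_neq0.
  rewrite invfM -mulrA !ipE; set s := b^-1 * _; lra.
have h1 := half x y; have := half y x; rewrite (distrC (g y)) => h2.
have -> : `|g x - g y| ^+ 2 = b * (2 * (2 * b)^-1 * `|g x - g y| ^+ 2).
  by field; exact: lt0r_neq0.
rewrite ler_pM2l//.
by move: h1 h2; rewrite !ipE; lra.
Qed.

End lipschitz_gradient.
End smooth_convex.

(** * Krasnoselskii-Mann iteration in the norm of an operator *)

Section krasnoselskii_mann.
Context (R : realType) (U : euclidType R) (P : U -> U).
Hypothesis Ppos : positive_definite P.
Implicit Types (x y z : U) (T : U -> U).

Lemma pform_sym x y : ip (P x) y = ip (P y) x.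
Proof. by rewrite Ppos.1 ipC. Qed.

Lemma pformDl x y z : ip (P (x + y)) z = ip (P x) z + ip (P y) z.
Proof. by rewrite Ppos.1 ipDl -!Ppos.1. Qed.

Lemma pformZl (a : R) x z : ip (P (a *: x)) z = a * ip (P x) z.
Proof. by rewrite Ppos.1 ipZl -Ppos.1. Qed.

Lemma pformNl x z : ip (P (- x)) z = - ip (P x) z.
Proof. by rewrite -scaleN1r pformZl mulN1r. Qed.

Definition pformE := (pformDl, pformNl, pformZl).

Lemma pform_ge0 x : 0 <= ip (P x) x.
Proof. by have [->|/Ppos.2/ltW//] := eqVneq x 0; rewrite ip0r. Qed.

Lemma normP_sqr x : normP P x ^+ 2 = ip (P x) x.
Proof. by rewrite sqr_sqrtr// pform_ge0. Qed.

Lemma normP_ge0 x : 0 <= normP P x.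
Proof. exact: sqrtr_ge0. Qed.

Lemma normP_le x y : (normP P x <= normP P y) = (ip (P x) x <= ip (P y) y).
Proof. by rewrite -!normP_sqr ler_sqr ?nnegrE ?normP_ge0. Qed.

(** The left-hand side equals [(1 - alpha) * s + alpha * t], where [s] and [t] are the squared norms
    of [x - y] and [Q x - Q y]. *)
Lemma averaged_diff_le T alpha x y : averaged (normP P) alpha T ->
  ip (P (T x - T y)) (T x - T y) + (1 - alpha) / alpha *
    ip (P ((x - T x) - (y - T y))) ((x - T x) - (y - T y)) <=
  ip (P (x - y)) (x - y).
Proof.
move=> [/andP[a0 a1] [Q QP TE]].
have := QP x y; rewrite normP_le.
have -> : T x - T y = (x - y) + alpha *: ((Q x - Q y) - (x - y)).
  by rewrite !TE; vec_ring.
have -> : (x - T x) - (y - T y) = - alpha *: ((Q x - Q y) - (x - y)).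
  by rewrite !TE; vec_ring.
move: (x - y) (Q x - Q y) => a b.
rewrite !(pformE, ipE) (pform_sym b a) => ba.
have -> : (1 - alpha) / alpha = alpha^-1 - 1 by field; exact: lt0r_neq0.
set s := ip (P a) a in ba *; set t := ip (P b) b in ba *.
set u := ip (P a) b.
apply: (@le_trans _ _ (s + alpha * (t - s))).
  by rewrite le_eqVlt; apply/orP; left; apply/eqP; field; exact: lt0r_neq0.
by rewrite gerDl pmulr_rle0// subr_le0.
Qed.

Lemma averaged_of_diff_le T alpha : 0 < alpha < 1 ->
  (forall x y, ip (P (T x - T y)) (T x - T y) + (1 - alpha) / alpha *
    ip (P ((x - T x) - (y - T y))) ((x - T x) - (y - T y)) <=
  ip (P (x - y)) (x - y)) -> averaged (normP P) alpha T.
Proof.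
move=> a01 TP; split=> //; have /andP[a0 a1] := a01.
have an0 := lt0r_neq0 a0.
(* The only map compatible with [T = (1 - alpha) Id + alpha Q]. *)
pose Q x := x - alpha^-1 *: (x - T x).
exists Q => [x y|x]; last first.
  by apply: ip_inj => z; rewrite !ipE; field.
rewrite normP_le.
have -> : Q x - Q y = (x - y) - alpha^-1 *: ((x - T x) - (y - T y)).
  by vec_ring.
have := TP x y; have -> : T x - T y = (x - y) - ((x - T x) - (y - T y)).
  by vec_ring.
move: (x - y) ((x - T x) - (y - T y)) => a b.
have -> : (1 - alpha) / alpha = alpha^-1 - 1 by field.
rewrite !(pformE, ipE) (pform_sym b a) => h.
rewrite -subr_ge0; set t := ip (P b) b in h *; set u := ip (P a) b in h *.
have {}h : 0 <= alpha^-1 * (2 * u - alpha^-1 * t).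
  by rewrite mulr_ge0 ?invr_ge0 ?(ltW a0)//; lra.
lra.
Qed.

(** Self-adjointness makes [P] linear, as testing against vectors shows; linear maps are bounded in
    finite dimension. *)
Lemma pform_le_norm : exists2 M : R, 0 < M & forall x, `|P x| <= M * `|x|.
Proof.
have Plin : linear P.
  by move=> a x y; apply: ip_inj => z; rewrite !(pformE, ipE).
pose l : {linear U -> U} := HB.pack P (GRing.isLinear.Build R U U _ P Plin).
have [M M0 MP] := hom_bounded (linfun l); exists (M + 1) => [|x].
  by rewrite ltr_wpDl.
have := MP x; rewrite lfunE/= => /le_trans; apply.
by rewrite ler_wpM2r// lerDl.
Qed.

(** [P] is injective, so [|x|] is at most [K * |P x|]; and [|P x| ^+ 2] is at most [M * ip (P x) x],
    by positivity of the form at [x - M^-1 *: P x]. The [+ 1] keeps the constant positive when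
    [K = 0]. *)
Lemma pform_ge_norm : exists2 c : R, 0 < c &
  forall x, c * `|x| ^+ 2 <= ip (P x) x.
Proof.
have Plin : linear P.
  by move=> a x y; apply: ip_inj => z; rewrite !(pformE, ipE).
pose l : {linear U -> U} := HB.pack P (GRing.isLinear.Build R U U _ P Plin).
have lP : lker (linfun l) == 0%VS.
  rewrite -subv0; apply/subvP => x; rewrite memv_ker lfunE/= => /eqP Px0.
  rewrite memv0; apply: contraTT isT => /Ppos.2.
  by rewrite Px0 ip0l ltxx.
have [K K0 KP] := hom_bounded (linfun l)^-1%VF.
have [M M0 MP] := pform_le_norm.
exists (M * (K ^+ 2 + 1))^-1; first by rewrite invr_gt0 mulr_gt0// ltr_wpDl ?sqr_ge0.
move=> x; rewrite ler_pdivrMl ?mulr_gt0// ?ltr_wpDl ?sqr_ge0//.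
have h1 : `|x| ^+ 2 <= K ^+ 2 * `|P x| ^+ 2.
  rewrite -exprMn ler_sqr ?nnegrE ?mulr_ge0//.
  by have := KP (P x); rewrite -[P x](lfunE l) lker0_lfunK.
have h2 : `|P x| ^+ 2 <= M * ip (P x) x.
  have := pform_ge0 (x - M^-1 *: P x).
  rewrite !(pformE, ipE) (pform_sym (P x) x) ipxx.
  have : ip (P (P x)) (P x) <= M * `|P x| ^+ 2.
    by apply: le_trans (ip_le_norm _ _) _; rewrite expr2 mulrA ler_wpM2r.
  rewrite -(ler_pM2l (_ : 0 < M^-1 * M^-1)) ?mulr_gt0 ?invr_gt0//.
  rewrite -[leRHS]mulrA (mulrA M^-1 M) mulVf ?lt0r_neq0// mul1r => h2 h3.
  rewrite mulrC -ler_pdivrMr// mulrC; lra.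
apply: le_trans h1 _; apply: le_trans (_ : (K ^+ 2 + 1) * `|P x| ^+ 2 <= _).
  by rewrite ler_wpM2r ?sqr_ge0// lerDl.
by rewrite (mulrC M) -mulrA ler_wpM2l// addr_ge0 ?sqr_ge0.
Qed.

Lemma normD3_sqr (x y z : U) :
  `|x + y + z| ^+ 2 <= 3 * (`|x| ^+ 2 + `|y| ^+ 2 + `|z| ^+ 2).
Proof.
have := ip_ge0 (x - y); have := ip_ge0 (y - z); have := ip_ge0 (x - z).
by rewrite -!ipxx !ipE (ipC y x) (ipC z x) (ipC z y); lra.
Qed.

Lemma averaged_cvg T alpha (h : nat -> U) p :
  averaged (normP P) alpha T -> T p = p -> (forall k, h k.+1 = T (h k)) ->
  exists2 hs, Fix T hs & h k @[k --> \oo] --> hs.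
Proof.
move=> avT Tp hT; have [/andP[a0 a1] _] := avT.
pose kap := (1 - alpha) / alpha.
have kap0 : 0 < kap by rewrite divr_gt0// subr_gt0.
have [c c0 cP] := pform_ge_norm; have [D D0 DP'] := pform_le_norm.
have DP x : ip (P x) x <= D * `|x| ^+ 2.
  by apply: le_trans (ip_le_norm _ _) _; rewrite expr2 mulrA ler_wpM2r.
pose a q k := ip (P (h k - q)) (h k - q).
have a_ge0 q k : 0 <= a q k by exact: pform_ge0.
have a_step q k : T q = q ->
    a q k.+1 + kap * ip (P (h k - h k.+1)) (h k - h k.+1) <= a q k.
  by move=> Tq; have := averaged_diff_le (h k) q avT; rewrite -hT Tq subrr subr0.
have a_ninc q : T q = q -> nonincreasing_seq (a q).
  move=> Tq; apply/nonincreasing_seqP => k; apply: le_trans (a_step q k Tq).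
  by rewrite lerDl mulr_ge0 ?pform_ge0// ltW.
have a_cvg : cvgn (a p).
  by apply: nonincreasing_is_cvgn; [exact: a_ninc|exists 0 => _ [k _ <-]].
(* Asymptotic regularity: the squared steps are bounded by the decrements of the convergent sequence
   [a p]. *)
have gap (e : R) : 0 < e -> \forall k \near \oo,
    ip (P (h k - h k.+1)) (h k - h k.+1) < e.
  move=> e0; have d0 : a p k - a p k.+1 @[k --> \oo] --> 0.
    rewrite -(subrr (limn (a p))); apply: cvgB => //.
    by rewrite cvg_shiftS.
  have ke : 0 < kap * e by rewrite mulr_gt0.
  near=> k; rewrite -(ltr_pM2l kap0); have := a_step p k Tp.
  have : a p k - a p k.+1 < kap * e by near: k; exact: (cvgr_lt 0 d0).
  by lra.
have [r hr] : exists r, forall k, `|h k| <= r.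
  exists (`|p| + (a p 0%N / c + 1)) => k.
  rewrite -[h k](subrK p) addrC; apply: le_trans (ler_normD _ _) _.
  rewrite lerD2l; have : `|h k - p| ^+ 2 <= a p 0%N / c.
    by rewrite ler_pdivlMr// mulrC; apply: le_trans (cP _) _; exact: a_ninc.
  by have := normr_ge0 (h k - p); nra.
pose F := h k @[k --> \oo].
have FK : F [set x | `|x| <= r] by exists 0%N => // k _ /=; exact: hr.
have [hs [_ hsF]] := closed_ball_compact (fmap_proper_filter h eventually_filter) FK.
(* Any eventual property holds at some index whose iterate is close to the cluster point [hs]. *)
have freq (e : R) (A : set nat) : 0 < e -> (\forall k \near \oo, A k) ->
    exists2 k, A k & `|h k - hs| ^+ 2 < e.
  move=> e0 [N _ NA].
  have FN : F (h @` [set k | (N <= k)%N]) by exists N => // k /= Nk; exists k.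
  have V : nbhs hs [set y | `|y - hs| ^+ 2 < e].
    apply/nbhs_normP; exists (Num.min 1 e); first by rewrite /= lt_min ltr01.
    move=> y /=; rewrite distrC lt_min => /andP[y1 ye].
    by have := normr_ge0 (y - hs); nra.
  have [_ [[k Nk <-] ke]] := hsF _ _ FN V.
  by exists k => //; apply: NA.
have Ths : T hs = hs.
  apply/esym/eqP; rewrite -subr_eq0 -normr_eq0 -sqrf_eq0; apply/eqP/le_anti.
  rewrite sqr_ge0 andbT; apply/ler_addgt0Pr => e e0; rewrite add0r.
  (* One term per piece of [hs - T hs]: distance from [hs] to the iterate, the step of the iterate,
     and the distance of the images, where passing to the norm of [P] and back costs [c^-1 * D]. *)
  pose M := 3 * (1 + c^-1 + c^-1 * D).
  have M0 : 0 < M by rewrite mulr_gt0// !addr_gt0// ?mulr_gt0// invr_gt0.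
  have eM : 0 < e / M by rewrite divr_gt0.
  have [k /= kgap kd] := freq _ _ eM (gap _ eM).
  have -> : hs - T hs = - (h k - hs) + (h k - h k.+1) + (T (h k) - T hs).
    by rewrite hT; vec_ring.
  apply: le_trans (normD3_sqr _ _ _) _; rewrite normrN.
  have h2 : `|h k - h k.+1| ^+ 2 <= c^-1 * (e / M).
    by rewrite ler_pdivlMl// (le_trans (cP _))// ltW.
  have h3 : `|T (h k) - T hs| ^+ 2 <= c^-1 * D * (e / M).
    rewrite -mulrA ler_pdivlMl// (le_trans (cP _))//.
    apply: le_trans (_ : ip (P (h k - hs)) (h k - hs) <= _).
      apply: le_trans (averaged_diff_le (h k) hs avT).
      by rewrite lerDl mulr_ge0 ?pform_ge0// ltW.
    by apply: le_trans (DP _) _; rewrite ler_pM2l// ltW.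
  have -> : e = 3 * (e / M + c^-1 * (e / M) + c^-1 * D * (e / M)).
    have -> : 3 * (e / M + c^-1 * (e / M) + c^-1 * D * (e / M)) = M * (e / M).
      by rewrite /M; ring.
    by rewrite mulrCA mulfV ?mulr1// lt0r_neq0.
  by rewrite ler_pM2l// !lerD// ltW.
exists hs => //; apply/cvgrPdist_lt => e e0.
(* Fejer monotonicity now holds with respect to [hs] itself, so one iterate within [d] keeps all
   later ones within [e]. *)
pose d := c * e ^+ 2 / D.
have d0 : 0 < d by rewrite divr_gt0// mulr_gt0// exprn_gt0.
have [k _ kd] := freq _ setT d0 filterT.
exists k => // j /= kj; rewrite distrC.
rewrite -ltr_sqr ?nnegrE ?(ltW e0)// -(ltr_pM2l c0).
apply: le_lt_trans (cP _) _.
apply: le_lt_trans (a_ninc hs Ths _ _ kj) _.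
apply: le_lt_trans (DP _) _.
by move: kd; rewrite /d ltr_pdivlMr// mulrC.
Unshelve. all: by end_near. Qed.

End krasnoselskii_mann.

(** * Optimality system *)

Section model_facts.
Context (R : realType) (X Y Z Zt Zf : euclidType R).
Context (A : 'Hom(X, Y)) (f : Y -> R) (Psi : Z -> \bar R) (mu : R).
Context (L : 'Hom(X, Z)) (Delta : set Zf) (C : 'Hom(X, Zf)) (B : 'Hom(Z, Zt)).
Context (b : R).
Hypothesis df : forall y, differentiable f y.
Hypotheses (GPsi : Gamma0 Psi) (cPsi : coercive Psi) (mu0 : 0 < mu).
Hypothesis Dcl : closed Delta.
Hypothesis Dconv : convex_set (Delta : set (convex_lmodType Zf)).
Hypothesis dom0 : edom (Psi \o L) `&` C @^-1` Delta !=set0.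
Hypothesis Gd : Gamma0 (fun x => (smooth A f mu L B x)%:E).
Hypothesis gb : b.-lipschitz (grad (smooth A f mu L B)).

Local Notation d := (smooth A f mu L B).
Local Notation g := (grad d).
Local Notation iota := (convex_indic Delta).

Let pPsi : proper_efun Psi. Proof. by case: GPsi. Qed.

Let rPsi : resolvable Psi. Proof. exact: coercive_resolvable. Qed.

Let D0 : Delta !=set0.
Proof. by have [x [_ Dx]] := dom0; exists (C x). Qed.

Let piota : proper_efun iota.
Proof. by case: (indic_Gamma0 D0 Dcl Dconv). Qed.

Let riota : resolvable iota. Proof. exact: indic_resolvable. Qed.

Lemma smooth_differentiable x : differentiable d x.
Proof.
apply: differentiableB.
  apply: differentiable_comp; last exact: df.
  by apply: linear_differentiable; exact: hom_continuous.
apply: differentiableM; first exact: differentiable_cst.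
apply: (@differentiable_quadratic _ _ _ _ (2 *: adj L (adj B (B (L x))))
  ((opnorm B * opnorm L) ^+ 2)) => h.
have -> : `|B (L (h + x))| ^+ 2 - `|B (L x)| ^+ 2 -
    ip (2 *: adj L (adj B (B (L x)))) h = `|B (L h)| ^+ 2.
  rewrite ipZl -!adjPr !homD -!ipxx.
  by move: (B (L h)) (B (L x)) => u v; rewrite !ipE (ipC u v); ring.
rewrite ger0_norm ?sqr_ge0// -exprMn ler_sqr ?nnegrE ?mulr_ge0 ?opnorm_ge0//.
apply: le_trans (opnorm_ub _ _) _.
by rewrite -mulrA ler_wpM2l ?opnorm_ge0// opnorm_ub.
Qed.

Lemma smooth_grad_le x y : d x + ip (g x) (y - x) <= d y.
Proof.
by apply: convex_grad_le; [case: Gd|exact: smooth_differentiable].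
Qed.

Lemma smooth_grad_lipschitz x y : `|g x - g y| <= b * `|x - y|.
Proof. exact: (gb (x := (x, y))). Qed.

(** This is [f o A] minus [mu] times the envelope along [L], written with the convex [d] so that its
    gradient inequalities apply. *)
Definition residual x : R :=
  d x + mu / 2 * `|B (L x)| ^+ 2 - mu * envelope Psi B (L x).

Lemma costE x : cost A f Psi mu L B x = (mu%:E * Psi (L x) + (residual x)%:E)%E.
Proof.
rewrite /cost gmeE// muleDr ?fin_num_adde_defl// addeCA -EFinN -EFinM -EFinD.
by congr (_ + _%:E)%E; rewrite /residual /smooth; ring.
Qed.

(* [g x + mu L^* B^* B v] acts as the gradient of [residual] at [x], although the
   minimizer [v] need not be unique. *)
Lemma residual_ge x y v : subdiff Psi v (adj B (B (L x - v))) ->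
  residual x + ip (y - x) (g x + mu *: adj L (adj B (B v))) <= residual y.
Proof.
(* The quadratic error in the upper bound on the envelope is compensated exactly by the quadratic
   term of [residual]. *)
move=> hv; have /andP[_ h1] := envelope_bounds GPsi cPsi (L y) hv.
have h2 := smooth_grad_le x y.
rewrite /residual ipDr ipZr -!adjP (ipC (y - x)).
move: h1; rewrite -adjP -!ipxx !homB.
move: (B (L y)) (B (L x)) (B v) => p q r.
set e1 := envelope _ _ _; set e2 := envelope _ _ _ => h1.
have := ler_wpM2l (ltW mu0) h1; move: h2.
by rewrite !ipE ?(ipC q p) ?(ipC r p) ?(ipC r q); lra.
Qed.

(** Descent for [d] and the lower bound on the envelope; this is the expansion along segments that
    [argmin_subdiff] takes as input. *)
Lemma residual_le x y v (t : R) : subdiff Psi v (adj B (B (L x - v))) ->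
  residual (t *: y + (1 - t) *: x) <= residual x +
    t * ip (y - x) (g x + mu *: adj L (adj B (B v))) +
    t ^+ 2 * (b / 2 * `|y - x| ^+ 2 + mu / 2 * `|B (L (y - x))| ^+ 2).
Proof.
have -> : t *: y + (1 - t) *: x = x + t *: (y - x) by vec_ring.
move: (y - x) => k hv.
have /andP[h1 _] := envelope_bounds GPsi cPsi (L (x + t *: k)) hv.
have h2 := descent smooth_grad_le smooth_grad_lipschitz x (t *: k).
rewrite /residual ipDr ipZr -!adjP (ipC k).
move: h2; rewrite normrZ exprMn real_normK ?num_real// ipZr => h2.
move: h1; rewrite -adjP -!ipxx (homB B (L x)) (homD L x) (homZ L).
rewrite (addrC (L x)) addrK (addrC (t *: L k)).
rewrite (homD B (L x)) (homZ B) => h1.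
have {}h1 := ler_wpM2l (ltW mu0) h1; move: h1.
move: (B (L k)) (B (L x)) (B v) => p q r.
move: h2; rewrite -ipxx.
set e1 := envelope _ _ _; set e2 := envelope _ _ _.
by rewrite !ipE ?(ipC q p) ?(ipC r p) ?(ipC r q); lra.
Qed.

(** [v] attains the envelope at [L x], while [mu *: w] and [mu *: z] are the multipliers of
    [mu Psi o L] and of the constraint. Solutions, zeros of [F + G] and fixed points of [T] are all
    compared with this system. *)
Definition kkt x v w z :=
  [/\ g x + mu *: adj L (adj B (B v)) + mu *: adj L w + mu *: adj C z = 0,
      subdiff Psi v (adj B (B (L x - v))), subdiff Psi (L x) w
    & subdiff iota (C x) z].

(** Add the three subgradient-type lower bounds, those for [Psi] and the indicator weighted by [mu]:
    their slopes sum to zero. *)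
Lemma kkt_solution x v w z : kkt x v w z ->
  solutions A f Psi mu L Delta C B x.
Proof.
move=> [e hv hw hz].
have DP y : iota y \is a fin_num -> Delta y.
  by move=> yfin; apply: contrapT => nDy; rewrite indicF in yfin.
have DCx : Delta (C x) by exact: DP (subdiff_fin piota hz).
split=> // y DCy; rewrite !costE.
have wfin := subdiff_fin pPsi hw.
have [->|yfin] := eqVneq (Psi (L y)) +oo%E.
  by rewrite gt0_muley ?lte_fin// addye// leey.
have {}yfin : Psi (L y) \is a fin_num.
  by rewrite fin_numE yfin andbT; case: pPsi.
have := hz (C y); rewrite !indicT// add0e lee_fin => h1.
have := hw (L y); rewrite -(fineK wfin) -(fineK yfin) -EFinD lee_fin => h2.
have {}h2 := ler_wpM2l (ltW mu0) h2; have {}h1 := ler_wpM2l (ltW mu0) h1.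
have h3 := residual_ge y hv.
rewrite -!EFinM -!EFinD lee_fin.
have : ip (y - x) (g x + mu *: adj L (adj B (B v)) + mu *: adj L w +
    mu *: adj C z) = 0 by rewrite e ip0r.
rewrite ipDr ipDr [ip _ (mu *: adj L w)]ipZr [ip _ (mu *: adj C z)]ipZr.
by rewrite -[ip _ (adj L w)]adjP -[ip _ (adj C z)]adjP !homB; lra.
Qed.

Hypothesis sum_rule : forall x,
  subdiff (fun x' => (cost A f Psi mu L B x' + constraint Delta C x')%E) x =
    [set s + t | s in subdiff (cost A f Psi mu L B) x
               & t in subdiff (constraint Delta C) x].
Hypothesis chain_Psi : forall x,
  subdiff (Psi \o L) x = adj L @` subdiff Psi (L x).
Hypothesis chain_iota : forall x, subdiff (constraint Delta C) x =
  adj C @` subdiff (convex_indic Delta) (C x).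

Lemma solution_kkt x : solutions A f Psi mu L Delta C B x ->
  exists v w z, kkt x v w z.
Proof.
move=> [DCx xmin].
have : subdiff (fun x' => (cost A f Psi mu L B x' + constraint Delta C x')%E) x 0.
  move=> y; rewrite ip0r adde0 /constraint (indicT DCx) adde0.
  have [DCy|nDCy] := pselect (Delta (C y)).
    by rewrite indicT// adde0; exact: xmin.
  rewrite indicF// addey ?leey// costE.
  have [PsiNy _] := pPsi; move: (PsiNy (L y)).
  by case: (Psi (L y)) => [r| |]// _; rewrite gt0_muley ?lte_fin.
rewrite sum_rule => -[s hs [t ht st]].
move: ht; rewrite chain_iota => -[z hz zt].
have [v hv] := envelope_attained B GPsi cPsi (L x).
(* The slope at [x] of [residual - ip _ s]. Since [s] is a subgradient of the cost, [x] minimizes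
   [phi] plus that function. *)
pose gam := g x + mu *: adj L (adj B (B v)) - s.
pose phi y := (mu%:E * (Psi \o L) y)%E.
have pPL : proper_efun (Psi \o L).
  have [PsiNy _] := pPsi; split=> [y|]; first exact: PsiNy.
  have [x0 [x0fin _]] := dom0; exists x0.
  by rewrite fin_numE (lt_eqF x0fin) andbT; exact: PsiNy.
have cPL : convex_efun (Psi \o L).
  by move=> r y y' r01 /=; rewrite homD !homZ; case: GPsi => _ _; apply.
have hphi : subdiff phi x (- gam).
  apply: (@argmin_subdiff _ _ phi (fun y => residual y - ip y s)).
  - exact: proper_scale.
  - exact: convex_scale.
  - move=> y.
    pose c := b / 2 * `|y - x| ^+ 2 + mu / 2 * `|B (L (y - x))| ^+ 2.
    exists c => r _.
    have -> : ip (r *: y + (1 - r) *: x) s = ip x s + r * ip (y - x) s.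
      by rewrite !ipE; ring.
    have : residual (r *: y + (1 - r) *: x) <= residual x +
      r * ip (y - x) (g x + mu *: adj L (adj B (B v))) + r ^+ 2 * c.
      exact: residual_le.
    rewrite /gam [ip (y - x) (_ - s)]ipDr ipNr.
    set u := ip (y - x) s; set w := ip (y - x) _; set q := residual _.
    move: (r ^+ 2 * c) => e; rewrite mulrBr => h.
    by rewrite -subr_ge0; move: h; rewrite -subr_ge0; congr (0 <= _); ring.
  - move=> y; have := hs y; rewrite !costE /phi/=.
    have [PLNy _] := pPL; move: (PLNy y) (PLNy x) => /=.
    case: (Psi (L y)) => [p| |]// _; case: (Psi (L x)) => [q| |]// _;
      rewrite -?EFinM -?EFinD ?lee_fin ?gt0_muley ?lte_fin ?addye ?leey ?leye_eq//.
    by rewrite ipDl ipNl; lra.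
have : subdiff (Psi \o L) x (mu^-1 *: - gam).
  by rewrite -(subdiff_scale _ _ _ mu0) scalerA mulfV ?lt0r_neq0// scale1r.
rewrite chain_Psi => -[w hw wE].
exists v, w, (mu^-1 *: z); split=> //.
  rewrite wE homZ !scalerA mulfV ?lt0r_neq0// !scale1r zt /gam.
  by rewrite -st; vec_ring.
(* Rescaling [z] is harmless because the indicator is unchanged by a positive factor. *)
rewrite -(subdiff_scale _ _ _ mu0) scalerA mulfV ?lt0r_neq0// scale1r.
suff -> : (fun y => (mu%:E * iota y)%E) = iota by [].
apply/funext => y; rewrite /convex_indic; case: ifP; rewrite ?mule0//.
by rewrite gt0_muley ?lte_fin.
Qed.

End model_facts.

(** * Zeros of [F + G] and fixed points of [T] *)

Section operators_relation.
Context (R : realType) (X Y Z Zt Zf : euclidType R).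
Context (A : 'Hom(X, Y)) (f : Y -> R) (Psi : Z -> \bar R) (mu : R).
Context (L : 'Hom(X, Z)) (Delta : set Zf) (C : 'Hom(X, Zf)) (B : 'Hom(Z, Zt)).
Hypotheses (GPsi : Gamma0 Psi) (cPsi : coercive Psi) (mu0 : 0 < mu).
Hypotheses (D0 : Delta !=set0) (Dcl : closed Delta).
Hypothesis Dconv : convex_set (Delta : set (convex_lmodType Zf)).

Local Notation g := (grad (smooth A f mu L B)).
Local Notation iota := (convex_indic Delta).
Local Notation H := (hprod (hprod (hprod X Z) Z) Zf).

Let pPsi : proper_efun Psi. Proof. by case: GPsi. Qed.

Let rPsi : resolvable Psi. Proof. exact: coercive_resolvable. Qed.

Let piota : proper_efun iota.
Proof. by case: (indic_Gamma0 D0 Dcl Dconv). Qed.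

Let riota : resolvable iota. Proof. exact: indic_resolvable. Qed.

Lemma zero_kkt x v w z :
  [set opF A f mu L B (x, v, w, z) + k | k in opG Psi mu L Delta C B (x, v, w, z)] 0
  <-> kkt A f Psi mu L Delta C B x v w z.
Proof.
have mun0 := lt0r_neq0 mu0.
split=> [[[[[k1 k2] k3] k4]] /= [[[-> [s2 hs2 <-]] [s3 hs3 <-]] [s4 hs4 <-]] e|].
  have e1 := congr1 (fun h : H => h.1.1.1) e.
  have e2 := congr1 (fun h : H => h.1.1.2) e.
  have e3 := congr1 (fun h : H => h.1.2) e.
  have e4 := congr1 (fun h : H => h.2) e.
  rewrite /= in e1 e2 e3 e4.
  split.
  - by rewrite -e1 !addrA.
  - suff -> : adj B (B (L x - v)) = s2 by [].
    apply: (scalerI mun0); rewrite -[LHS]addr0 -[0 in LHS]e2 !homB; vec_ring.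
  - rewrite -(subdiff_conjugate _ _ pPsi rPsi); suff -> : L x = s3 by [].
    by apply: (scalerI mun0); rewrite -[LHS]addr0 -[0 in LHS]e3; vec_ring.
  - rewrite -(subdiff_conjugate _ _ piota riota); suff -> : C x = s4 by [].
    by apply: (scalerI mun0); rewrite -[LHS]addr0 -[0 in LHS]e4; vec_ring.
move=> [e1 h2 h3 h4].
exists (mu *: adj L (adj B (B v)) + mu *: adj L w + mu *: adj C z,
  - (mu *: adj B (B (L x))) + mu *: adj B (B (L x - v)),
  - (mu *: L x) + mu *: L x, - (mu *: C x) + mu *: C x).
  split; last by exists (C x) => //; apply/subdiff_conjugate.
  split; last by exists (L x) => //; apply/subdiff_conjugate.
  by split=> //; exists (adj B (B (L x - v))).
rewrite /=; congr (_, _, _, _).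
- by rewrite -[RHS]e1 !addrA.
- by rewrite !homB; vec_ring.
- by vec_ring.
- by vec_ring.
Qed.

Section steps.
Context (sigma tau : R).
Hypotheses (sigma0 : 0 < sigma) (tau0 : 0 < tau).

(** The inclusion [P h - F h] in [P h' + G h'], with [h'] the image of [h], written block by
    block. *)
Definition resolvent_step (x : X) (v w : Z) (z : Zf)
    (xi : X) (zeta eta : Z) (zs : Zf) :=
  [/\ sigma *: (x - xi) = g x + mu *: adj L (adj B (B v)) + mu *: adj L w +
        mu *: adj C z,
      subdiff Psi zeta (mu^-1 *: ((2 * mu) *: adj B (B (L xi)) -
        mu *: adj B (B (L x)) + tau *: v - mu *: adj B (B v) - tau *: zeta)),
      subdiff (conjugate Psi) eta (2 *: L xi - L x + w - eta)
    & subdiff (conjugate iota) zs (2 *: C xi - C x + z - zs)].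

(** Each proximal line is equivalent to its optimality condition; [Id] minus the projection is the
    resolvent of the conjugate indicator, by Moreau decomposition. *)
Lemma opT_step x v w z xi zeta eta zs :
  opT A f Psi mu L Delta C B sigma tau (x, v, w, z) = (xi, zeta, eta, zs) <->
  resolvent_step x v w z xi zeta eta zs.
Proof.
have mun0 := lt0r_neq0 mu0; have sn0 := lt0r_neq0 sigma0.
have tn0 := lt0r_neq0 tau0; have mt0 : 0 < mu / tau by rewrite divr_gt0.
have proxPsi y p : prox (fun u => ((mu / tau)%:E * Psi u)%E) y = p <->
    subdiff Psi p ((mu / tau)^-1 *: (y - p)).
  rewrite prox_subdiff; last 2 first.
  - exact: proper_scale.
  - apply: coercive_resolvable; first exact: Gamma0_scale.
    exact: coercive_scale.
  rewrite -(subdiff_scale Psi p _ mt0) scalerA mulfV ?scale1r//.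
  by rewrite lt0r_neq0.
have conjP y p : prox (conjugate Psi) y = p <->
    subdiff (conjugate Psi) p (y - p).
  apply: prox_subdiff; first exact: proper_conjugate.
  exact: resolvable_conjugate.
have projP y p : y - Defs.proj Delta y = p <->
    subdiff (conjugate iota) p (y - p).
  rewrite subdiff_conjugate// projE//; split=> [<-|h].
    by rewrite subKr -prox_subdiff.
  by rewrite (subdiff_prox (p := y - p))// ?subKr.
have argE u u' u'' v' : (mu / tau)^-1 *: ((2 * mu / tau) *: u -
    (mu / tau) *: u' + (v' - (mu / tau) *: u'') - zeta) =
    mu^-1 *: ((2 * mu) *: u - mu *: u' + tau *: v' - mu *: u'' - tau *: zeta).
  by apply: ip_inj => y; rewrite !ipE; field; rewrite mun0 tn0.
have xiP : x - sigma^-1 *: g x - (mu / sigma) *: adj L (adj B (B v))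
            - (mu / sigma) *: adj L w - (mu / sigma) *: adj C z = xi <->
    sigma *: (x - xi) = g x + mu *: adj L (adj B (B v)) + mu *: adj L w +
        mu *: adj C z.
  split=> [<-|e].
    by apply: ip_inj => y; rewrite !ipE; field.
  have -> : xi = x - sigma^-1 *: (sigma *: (x - xi)).
    by rewrite scalerA mulVf// scale1r subKr.
  by rewrite e; apply: ip_inj => y; rewrite !ipE; field.
rewrite /opT /resolvent_step; split=> [[e1 e2 e3 e4]|[/xiP e1 e2 e3 e4]].
  rewrite e1 in e2 e3 e4; split; first exact/xiP.
  - by rewrite -argE; exact/proxPsi.
  - exact/conjP.
  - exact/projP.
rewrite e1; congr (_, _, _, _).
- by apply/proxPsi; rewrite argE.
- exact/conjP.
- exact/projP.
Qed.

Lemma fix_kkt x v w z : Fix (opT A f Psi mu L Delta C B sigma tau) (x, v, w, z) <->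
  kkt A f Psi mu L Delta C B x v w z.
Proof.
have mun0 := lt0r_neq0 mu0.
rewrite [X in X <-> _]opT_step; rewrite /resolvent_step /kkt.
have -> : 2 *: L x - L x + w - w = L x by vec_ring.
have -> : 2 *: C x - C x + z - z = C x by vec_ring.
rewrite subrr scaler0.
have -> : mu^-1 *: ((2 * mu) *: adj B (B (L x)) - mu *: adj B (B (L x)) +
    tau *: v - mu *: adj B (B v) - tau *: v) = adj B (B (L x - v)).
  by rewrite !homB; apply: ip_inj => y; rewrite !ipE; field.
have Pw := subdiff_conjugate (L x) w pPsi rPsi.
have Pz := subdiff_conjugate (C x) z piota riota.
by split=> -[e h2 /Pw h3 /Pz h4]; split.
Qed.

End steps.
End operators_relation.

(** * The preconditioner [P] and the contraction estimate *)

Section preconditioner.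
Context (R : realType) (X Z Zt Zf : euclidType R) (mu : R).
Context (L : 'Hom(X, Z)) (C : 'Hom(X, Zf)) (B : 'Hom(Z, Zt)).
Context (sigma tau rho : R).
Hypotheses (mu0 : 0 < mu) (rho0 : 0 < rho).
Hypothesis tau_gt : (2 * rho)^-1 < tau.
Hypothesis step : stepsize mu L C B sigma tau rho.

Local Notation H := (hprod (hprod (hprod X Z) Z) Zf).
Local Notation P := (opP mu L C B sigma tau).
Local Notation th := (theta mu L C B sigma tau rho).

Lemma ip_hprod (x x' : X) (v v' w w' : Z) (z z' : Zf) :
  ip ((x, v, w, z) : H) (x', v', w', z') =
  ip x x' + ip v v' + ip w w' + ip z z'.
Proof. by []. Qed.

Lemma opP_form (x x' : X) (v v' w w' : Z) (z z' : Zf) :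
  ip (P (x, v, w, z)) (x', v', w', z') =
  sigma * ip x x' - mu * ip (B v) (B (L x')) - mu * ip w (L x')
  - mu * ip z (C x') - mu * ip (B (L x)) (B v') + tau * ip v v'
  - mu * ip (L x) w' + mu * ip w w' - mu * ip (C x) z' + mu * ip z z'.
Proof. by rewrite /opP ip_hprod !ipE -!adjPr; ring. Qed.

Lemma opP_sym (h h' : H) : ip (P h) h' = ip h (P h').
Proof.
case: h => [[[x v] w] z]; case: h' => [[[x' v'] w'] z'].
rewrite [RHS]ipC !opP_form (ipC x') (ipC v') (ipC w' w) (ipC z' z).
rewrite (ipC (B v')) (ipC (B (L x'))) (ipC w') (ipC z') (ipC (L x')) (ipC (C x')).
by ring.
Qed.

(** [s'] bounds from below the Schur complement left in the first block once [w] and [z] are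
    eliminated; [c] bounds the coupling of [x] with [v]. *)
Local Notation s' := (sigma - mu * normLC L C).
Local Notation c := (mu * normBBL L B).

Let tau0 : 0 < tau.
Proof. by apply: lt_trans tau_gt; rewrite invr_gt0 mulr_gt0. Qed.

Let rt1 : 1 < 2 * rho * tau.
Proof. by move: tau_gt; rewrite -ltr_pdivrMl ?mulr_gt0// mulr1. Qed.

Let step' : 2 * rho * c ^+ 2 + tau < s' * (2 * rho * tau - 1).
Proof.
move: step; rewrite /stepsize addrC -ltrBrDr ltr_pdivrMr ?subr_gt0//.
by apply: le_lt_trans; rewrite exprMn mulrA.
Qed.

Let s'0 : 0 < s'.
Proof.
have : 0 < s' * (2 * rho * tau - 1).
  apply: lt_trans step'; rewrite ltr_wpDl// mulr_ge0 ?sqr_ge0//.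
  by rewrite ltW// mulr_gt0.
by rewrite pmulr_lgt0// subr_gt0.
Qed.

Let detE : sigma * tau - tau * mu * normLC L C - mu ^+ 2 * normBBL L B ^+ 2 =
  s' * tau - c ^+ 2.
Proof. by ring. Qed.

(** The step size condition rearranged: trace below [2 * rho] times determinant, which amounts to
    [theta < 2]. *)
Let det_gt : s' + tau < 2 * rho * (s' * tau - c ^+ 2).
Proof. by move: step'; lra. Qed.

Let det0 : 0 < s' * tau - c ^+ 2.
Proof.
have : 0 < 2 * rho * (s' * tau - c ^+ 2).
  by apply: lt_trans det_gt; rewrite addr_gt0.
by rewrite pmulr_rgt0// mulr_gt0.
Qed.

Lemma theta_rho : th * rho * (s' * tau - c ^+ 2) = s' + tau.
Proof.
rewrite /theta detE addrAC; move: det0; move: (s' * tau - _) => D D0.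
have Dn := lt0r_neq0 D0; have rn := lt0r_neq0 rho0; field.
by rewrite Dn rn.
Qed.

Lemma theta_gt0 : 0 < th.
Proof. rewrite /theta detE addrAC; apply: divr_gt0.
  by apply: addr_gt0; [exact: s'0|exact: tau0].
by apply: mulr_gt0; [exact: rho0|exact: det0]. Qed.

Lemma theta_lt2 : th < 2.
Proof.
have rD : 0 < rho * (s' * tau - c ^+ 2) by rewrite mulr_gt0 ?det0.
by rewrite /theta detE addrAC ltr_pdivrMr// mulrA det_gt.
Qed.

Lemma normLC_ub x : `|L x| ^+ 2 + `|C x| ^+ 2 <= normLC L C * `|x| ^+ 2.
Proof.
have -> : `|L x| ^+ 2 + `|C x| ^+ 2 =
    ip (((adj L \o L)%VF + (adj C \o C)%VF) x) x.
  by rewrite !lfunE/= !comp_lfunE ipDl -!adjPr !ipxx.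
apply: le_trans (ip_le_norm _ _) _; rewrite expr2 mulrA ler_wpM2r//.
exact: opnorm_ub.
Qed.

Lemma normBBL_ub x v : ip (B (L x)) (B v) <= normBBL L B * `|x| * `|v|.
Proof.
rewrite adjPr; apply: le_trans (ip_le_norm _ _) _; rewrite ler_wpM2r//.
by have := opnorm_ub (adj B \o B \o L)%VF x; rewrite !comp_lfunE.
Qed.

(* The 2x2 matrix [[s', - c], [- c, tau]] bounds [P] from below in the first two
   components, and [th * rho] is its trace divided by its determinant, hence an
   upper bound for the norm of its inverse. *)
Lemma opP_ge (x : X) (v w : Z) (z : Zf) :
  `|x| ^+ 2 + `|v| ^+ 2 <= th * rho * ip (P (x, v, w, z)) (x, v, w, z).
Proof.
have h1 := normLC_ub x; have h2 := normBBL_ub x v.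
have h3 : s' * `|x| ^+ 2 + tau * `|v| ^+ 2 - 2 * c * `|x| * `|v| <=
    ip (P (x, v, w, z)) (x, v, w, z).
  (* Completing the squares in [w] and [z] leaves [- mu * (|L x| ^+ 2 + |C x| ^+ 2)], controlled by
     [normLC]. *)
  have := ip_ge0 (w - L x); have := ip_ge0 (z - C x).
  rewrite opP_form (ipC (B v)) !ipE !ipxx (ipC (L x) w) (ipC (C x) z).
  move=> h4 h5; have {}h4 := mulr_ge0 (ltW mu0) h4.
  have {}h5 := mulr_ge0 (ltW mu0) h5.
  have := ler_wpM2l (ltW mu0) h1; have := ler_wpM2l (ltW mu0) h2; lra.
rewrite -(ler_pM2r det0) mulrAC theta_rho.
apply: le_trans (_ : (s' + tau) * (s' * `|x| ^+ 2 + tau * `|v| ^+ 2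
   - 2 * c * `|x| * `|v|) <= _); last by rewrite ler_wpM2l// ltW// addr_gt0.
(* By Cayley-Hamilton for the 2x2 matrix, the difference of the two sides is exactly the sum of
   these squares. *)
have := sqr_ge0 (s' * `|x| - c * `|v|); have := sqr_ge0 (tau * `|v| - c * `|x|).
set t := s'; set k := c; lra.
Qed.

(** [opP_ge] settles the case where [x] or [v] is nonzero; otherwise the form reduces to
    [mu * (|w| ^+ 2 + |z| ^+ 2)]. *)
Lemma opP_positive : positive_definite P.
Proof.
split=> [h h'|]; first exact: opP_sym.
case=> [[[x v] w] z] h0.
have tr0 : 0 < th * rho by rewrite mulr_gt0// theta_gt0.
have := opP_ge x v w z; have [xv0|xv0] := eqVneq (`|x| ^+ 2 + `|v| ^+ 2) 0.
  move=> _; move: xv0 => /eqP; rewrite paddr_eq0 ?sqr_ge0// !sqrf_eq0 !normr_eq0.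
  move=> /andP[/eqP x0 /eqP v0]; rewrite x0 v0 in h0 *.
  rewrite opP_form !(hom0, ip0l, ip0r) !mulr0 !subr0 !add0r -mulrDr.
  rewrite mulr_gt0// lt_neqAle eq_sym addr_ge0 ?ip_ge0// andbT.
  apply: contra h0; rewrite paddr_eq0 ?ip_ge0// => /andP[/eqP w0 /eqP z0'].
  by rewrite (ip_norm_eq0 (x := w)) ?w0// (ip_norm_eq0 (x := z)) ?z0'.
move=> /(lt_le_trans _) h; rewrite -(pmulr_rgt0 _ tr0); apply: h.
by rewrite lt_neqAle eq_sym xv0 addr_ge0 ?sqr_ge0.
Qed.

(* Differences of two runs of the resolvent step: with [E] the difference of the
   images and [D] that of the arguments, monotonicity gives
   [<P (D - E), E> >= <dg, dxi> + mu <B dv, B dzeta>], and cocoercivity then absorbs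
   the right-hand side into [<P (D - E), D - E>]. *)
Lemma resolvent_step_le (dx dxi dg : X) (dv dw dzeta deta : Z) (dz dzs : Zf) :
  rho * (mu * opnorm B ^+ 2) <= 1 ->
  sigma *: (dx - dxi) = dg + mu *: adj L (adj B (B dv)) + mu *: adj L dw +
    mu *: adj C dz ->
  0 <= ip dzeta ((2 * mu) *: adj B (B (L dxi)) - mu *: adj B (B (L dx)) +
    tau *: dv - mu *: adj B (B dv) - tau *: dzeta) ->
  0 <= ip deta (2 *: L dxi - L dx + dw - deta) ->
  0 <= ip dzs (2 *: C dxi - C dx + dz - dzs) ->
  rho * `|dg| ^+ 2 <= ip dg dx ->
  forall D E : H, D = (dx, dv, dw, dz) -> E = (dxi, dzeta, deta, dzs) ->
  ip (P E) E + (1 - th / 2) * ip (P (D - E)) (D - E) <= ip (P D) D.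
Proof.
move=> rB ex m2 m3 m4 coco D E DE EE; have Ppos := opP_positive.
have [K K_def] : exists K, K = D - E by exists (D - E).
rewrite -K_def.
have KD : D = E + K by rewrite K_def addrC subrK.
rewrite [in X in _ <= X]KD (pformDl Ppos) !ipDr (pform_sym Ppos E K).
suff : - (th / 4) * ip (P K) K <= ip (P K) E by lra.
have KE : K = (dx - dxi, dv - dzeta, dw - deta, dz - dzs).
  by rewrite K_def DE EE.
have hK := opP_ge (dx - dxi) (dv - dzeta) (dw - deta) (dz - dzs).
rewrite -KE in hK.
(* Cocoercivity of the second block [mu B^* B] of [F]. *)
have hBv : rho * `|mu *: adj B (B dv)| ^+ 2 <= mu * `|B dv| ^+ 2.
  rewrite normrZ gtr0_norm// exprMn.
  have h : `|adj B (B dv)| ^+ 2 <= opnorm B ^+ 2 * `|B dv| ^+ 2.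
    by rewrite -exprMn ler_sqr ?nnegrE ?mulr_ge0 ?opnorm_ge0// adj_ub.
  apply: le_trans (_ : rho * (mu ^+ 2 * (opnorm B ^+ 2 * `|B dv| ^+ 2)) <= _).
    by rewrite ler_wpM2l ?(ltW rho0)// ler_wpM2l ?sqr_ge0.
  have -> : rho * (mu ^+ 2 * (opnorm B ^+ 2 * `|B dv| ^+ 2)) =
    rho * (mu * opnorm B ^+ 2) * (mu * `|B dv| ^+ 2) by ring.
  by rewrite ler_piMl// mulr_ge0 ?sqr_ge0// ltW.
have hmono : ip dg dxi + mu * ip (B dv) (B dzeta) <= ip (P K) E.
  have exE := congr1 (fun u => ip u dxi) ex.
  move: exE m2 m3 m4.
  rewrite KE EE opP_form.
  rewrite !ipE -!adjPr -!adjP !homE !ipE => exE m2 m3 m4.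
  have {}m3 := mulr_ge0 (ltW mu0) m3; have {}m4 := mulr_ge0 (ltW mu0) m4.
  rewrite !(ipC _ (L dx)) !(ipC _ (L dxi)) in exE m3 m4 *.
  rewrite !(ipC _ (C dx)) !(ipC _ (C dxi)) in exE m3 m4 *.
  rewrite !(ipC _ (B (L dx))) !(ipC _ (B (L dxi))) in m2 exE *.
  rewrite ?(ipC dzeta dv) ?(ipC deta dw) ?(ipC dzs dz) in m2 m3 m4 *.
  rewrite ?(ipC (B dzeta) (B dv)) in m2 *.
  lra.
(* Weights chosen so that cocoercivity absorbs the first term, while [opP_ge] turns the second into
   [th / 4 * ip (P K) K]. *)
have young (V : euclidType R) (q k : V) :
    ip q k <= rho * `|q| ^+ 2 + (4 * rho)^-1 * `|k| ^+ 2.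
  have := ip_ge0 (q - (2 * rho)^-1 *: k); rewrite !ipE (ipC k q) !ipxx => h.
  rewrite -subr_ge0; have := mulr_ge0 (ltW rho0) h; congr (0 <= _).
  by field; exact: lt0r_neq0.
have y1 := young _ dg (dx - dxi).
have y2 := young _ (mu *: adj B (B dv)) (dv - dzeta).
have : th * rho * ip (P K) K * (4 * rho)^-1 = th / 4 * ip (P K) K.
  by field; exact: lt0r_neq0.
have r40 : 0 <= (4 * rho)^-1 by rewrite invr_ge0 mulr_ge0// ltW.
have := ler_wpM2r r40 hK.
move: y1 y2; rewrite [ip (mu *: _) (_ - _)]ipZl -adjPr !homB !ipDr !ipNr ipxx.
by lra.
Qed.

End preconditioner.

Lemma opT_diff_le (R : realType) (X Y Z Zt Zf : euclidType R)
    (A : 'Hom(X, Y)) (f : Y -> R) (Psi : Z -> \bar R) (mu : R)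
    (L : 'Hom(X, Z)) (Delta : set Zf) (C : 'Hom(X, Zf)) (B : 'Hom(Z, Zt))
    (sigma tau rho : R) :
  let T := opT A f Psi mu L Delta C B sigma tau in
  let P := opP mu L C B sigma tau in
  let g := grad (smooth A f mu L B) in
  Gamma0 Psi -> coercive Psi -> 0 < mu ->
  Delta !=set0 -> closed Delta -> convex_set (Delta : set (convex_lmodType Zf)) ->
  0 < sigma -> 0 < rho -> (2 * rho)^-1 < tau ->
  stepsize mu L C B sigma tau rho ->
  rho * (mu * opnorm B ^+ 2) <= 1 ->
  (forall x y, rho * `|g x - g y| ^+ 2 <= ip (g x - g y) (x - y)) ->
  forall h k, ip (P (T h - T k)) (T h - T k) +
    (1 - theta mu L C B sigma tau rho / 2) *
    ip (P ((h - T h) - (k - T k))) ((h - T h) - (k - T k)) <=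
    ip (P (h - k)) (h - k).
Proof.
move=> T P g GPsi cPsi mu0 D0 Dcl Dconv sigma0 rho0 tau_gt st rB coco h k.
have tau0 : 0 < tau by apply: lt_trans tau_gt; rewrite invr_gt0 mulr_gt0.
have [pPsi _ _] := GPsi; have rPsi := coercive_resolvable GPsi cPsi.
have [piota _ _] := indic_Gamma0 D0 Dcl Dconv.
have riota := indic_resolvable D0 Dcl Dconv.
have mun0 := lt0r_neq0 mu0.
have -> : (h - T h) - (k - T k) = (h - k) - (T h - T k).
  by vec_ring.
case: h => [[[x v] w] z]; case: k => [[[x' v'] w'] z'].
case Th : (T (x, v, w, z)) => [[[xi zeta] eta] zs].
case Tk : (T (x', v', w', z')) => [[[xi' zeta'] eta'] zs'].
have /opT_step [] := Th => // e1 m1 m2 m3.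
have /opT_step [] := Tk => // e1' m1' m2' m3'.
apply: (@resolvent_step_le _ _ _ _ _ mu L C B sigma tau rho mu0 rho0 tau_gt st
  (x - x') (xi - xi') (g x - g x') (v - v') (w - w') (zeta - zeta')
  (eta - eta') (z - z') (zs - zs')) => //.
- have -> : sigma *: (x - x' - (xi - xi')) =
    sigma *: (x - xi) - sigma *: (x' - xi') by vec_ring.
  by rewrite e1 e1' !homB; vec_ring.
- have := mulr_ge0 (ltW mu0) (subdiff_monotone pPsi m1 m1').
  congr (0 <= _); rewrite -ipZr; congr ip; rewrite !homB.
  by apply: ip_inj => y; rewrite !ipE; field.
- have := subdiff_monotone (proper_conjugate pPsi rPsi) m2 m2'.
  by congr (0 <= ip _ _); rewrite !homB; vec_ring.
- have := subdiff_monotone (proper_conjugate piota riota) m3 m3'.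
  by congr (0 <= ip _ _); rewrite !homB; vec_ring.
Qed.

(** [hprod] carries the Hilbert norm, so continuity comes from linearity in finite dimension. *)
Lemma Xi_continuous (R : realType) (X Z Zf : euclidType R) :
  continuous (@Xi R X Z Zf).
Proof.
have Xl : linear (@Xi R X Z Zf) by [].
pose l : {linear hprod (hprod (hprod X Z) Z) Zf -> X} :=
  HB.pack (@Xi R X Z Zf) (GRing.isLinear.Build R _ X _ _ Xl).
have <- : linfun l = @Xi R X Z Zf :> (_ -> _).
  by apply/funext => h; rewrite lfunE.
exact: hom_continuous.
Qed.

Theorem theorem2 (R : realType) (X Y Z Zt Zf : euclidType R)
    (A : 'Hom(X, Y)) (f : Y -> R) (Psi : Z -> \bar R) (mu : R)
    (L : 'Hom(X, Z)) (Delta : set Zf) (C : 'Hom(X, Zf)) (B : 'Hom(Z, Zt))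
    (beta_f beta_d : R) :
  (* setting, including (i) *)
  Gamma0 (fun y => (f y)%:E) ->
  (forall y, differentiable f y) ->
  beta_f.-lipschitz (grad f) ->
  Gamma0 Psi -> coercive Psi ->
  0 < mu ->
  closed Delta -> convex_set (Delta : set (convex_lmodType Zf)) ->
  edom (Psi \o L) `&` C @^-1` Delta !=set0 ->
  (* (ii) *)
  Gamma0 (fun x => (smooth A f mu L B x)%:E) ->
  (* (iii) *)
  solutions A f Psi mu L Delta C B !=set0 ->
  (* (iv) *)
  (forall x,
    subdiff (fun x' => (cost A f Psi mu L B x' + constraint Delta C x')%E) x =
    [set s + t | s in subdiff (cost A f Psi mu L B) x
               & t in subdiff (constraint Delta C) x]) ->
  (forall x, subdiff (Psi \o L) x = adj L @` subdiff Psi (L x)) ->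
  (forall x, subdiff (constraint Delta C) x =
             adj C @` subdiff (convex_indic Delta) (C x)) ->
  (* Lipschitz constant of the gradient of the smooth part *)
  0 < beta_d -> beta_d.-lipschitz (grad (smooth A f mu L B)) ->
  let rho := (Num.max beta_d (mu * opnorm B ^+ 2))^-1 in
  let S := solutions A f Psi mu L Delta C B in
  let F := opF A f mu L B in
  let G := opG Psi mu L Delta C B in
  let T sigma tau := opT A f Psi mu L Delta C B sigma tau in
  let P sigma tau := opP mu L C B sigma tau in
  let th sigma tau := theta mu L C B sigma tau rho in
  [/\ (* (a) *)
      forall x : X, S x <->
        exists (v w : Z) (z : Zf),
          [set F (x, v, w, z) + g | g in G (x, v, w, z)] 0,
      (* (b) *)
      forall sigma tau : R, 0 < sigma -> 0 < tau ->
        S = @Xi R X Z Zf @` Fix (T sigma tau),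
      (* (c) *)
      forall sigma tau : R, 0 < sigma -> (2 * rho)^-1 < tau ->
        stepsize mu L C B sigma tau rho ->
        [/\ positive_definite (P sigma tau),
            averaged (normP (P sigma tau)) (2 / (4 - th sigma tau))
              (T sigma tau)
          & th sigma tau < 2]
    & (* (d) *)
      forall sigma tau : R, 0 < sigma -> (2 * rho)^-1 < tau ->
        stepsize mu L C B sigma tau rho ->
        forall (h0 : hprod (hprod (hprod X Z) Z) Zf) (h : nat -> _),
          h 0%N = h0 -> (forall k, h k.+1 = T sigma tau (h k)) ->
          (exists2 hs, Fix (T sigma tau) hs & h k @[k --> \oo] --> hs) /\
          (exists2 xs, S xs & Xi (h k) @[k --> \oo] --> xs)].
Proof.
move=> _ df _ GPsi cPsi mu0 Dcl Dconv dom0 Gd S0 sum_rule chain_Psi chain_iota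
  b0 gb rho S F G T P th.
have D0 : Delta !=set0 by have [x [_ Dx]] := dom0; exists (C x).
have max0 : 0 < Num.max beta_d (mu * opnorm B ^+ 2) by rewrite lt_max b0.
have rho0 : 0 < rho by rewrite invr_gt0.
have rb : rho * beta_d <= 1 by rewrite ler_pdivrMl// mulr1 le_max lexx.
have rB : rho * (mu * opnorm B ^+ 2) <= 1.
  by rewrite ler_pdivrMl// mulr1 le_max lexx orbT.
have coco x y : rho * `|grad (smooth A f mu L B) x - grad (smooth A f mu L B) y| ^+ 2
    <= ip (grad (smooth A f mu L B) x - grad (smooth A f mu L B) y) (x - y).
  (* Baillon-Haddad gives the constant [beta_d^-1], which is at least [rho]. *)
  have := cocoercive_grad (smooth_grad_le df Gd) b0 (smooth_grad_lipschitz gb) x y.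
  move: (grad _ x - grad _ y) (x - y) => p q pq.
  have pq0 : 0 <= ip p q.
    by rewrite -(pmulr_rge0 _ b0); apply: le_trans pq; rewrite sqr_ge0.
  apply: le_trans (_ : rho * (beta_d * ip p q) <= _); first by rewrite ler_pM2l.
  by rewrite mulrA ler_piMl.
have Skkt x : S x <-> exists v w z, kkt A f Psi mu L Delta C B x v w z.
  split; first by apply: (solution_kkt (b := beta_d)).
  by move=> [v [w [z]]]; exact: kkt_solution.
have SFix sigma tau : 0 < sigma -> 0 < tau ->
    S = @Xi R X Z Zf @` Fix (T sigma tau).
  move=> s0 t0; apply/seteqP; split=> [x /Skkt[v [w [z]]] h|].
    by exists (x, v, w, z) => //; apply/fix_kkt.
  move=> _ [[[[x v] w] z] /fix_kkt h <-]; apply/Skkt.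
  by exists v, w, z; exact: h.
have taupos tau : (2 * rho)^-1 < tau -> 0 < tau.
  by move=> ?; apply: lt_trans (_ : (2 * rho)^-1 < tau); rewrite ?invr_gt0 ?mulr_gt0.
have av sigma tau : 0 < sigma -> (2 * rho)^-1 < tau ->
    stepsize mu L C B sigma tau rho ->
    averaged (normP (P sigma tau)) (2 / (4 - th sigma tau)) (T sigma tau).
  move=> s0 tt st.
  have thl : th sigma tau < 2 := theta_lt2 rho0 tt st.
  have thp : 0 < th sigma tau := theta_gt0 rho0 tt st.
  apply: averaged_of_diff_le; first exact: (opP_positive mu0 rho0 tt st).
    move: (th sigma tau) thl thp => t t2 t0; have t4 : 0 < 4 - t by lra.
    by rewrite divr_gt0//= ltr_pdivrMr//; lra.
  (* The value of [alpha] is the one matching the factor [1 - th / 2] of [opT_diff_le]. *)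
  have -> : (1 - 2 / (4 - th sigma tau)) / (2 / (4 - th sigma tau)) =
      1 - th sigma tau / 2.
    move: (th sigma tau) thl => t t2; field.
    by rewrite lt0r_neq0//; lra.
  exact: opT_diff_le.
split=> //.
- move=> x; apply: iff_trans (Skkt x) _.
  by split=> -[v [w [z h]]]; exists v, w, z; apply/zero_kkt.
- move=> sigma tau s0 tt st; split; [exact: (opP_positive mu0 rho0 tt st)|exact: av|].
  exact: (theta_lt2 rho0 tt st).
- move=> sigma tau s0 tt st h0 h _ hT.
  have S_E := SFix sigma tau s0 (taupos _ tt).
  (* Nonemptiness of [S] provides the fixed point from which Fejer monotonicity starts. *)
  have [p Tp _] : (@Xi R X Z Zf @` Fix (T sigma tau)) (xget 0 S).
    by rewrite -S_E; exact: xgetPex.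
  have [hs Ths hcvg] := averaged_cvg (opP_positive mu0 rho0 tt st)
    (av sigma tau s0 tt st) Tp hT.
  split; first by exists hs.
  exists (Xi hs); first by rewrite S_E; exists hs.
  by apply: continuous_cvg hcvg; exact: Xi_continuous.
Qed.
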